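(* Let $\Gamma$ be a loop of loops of genus $g\ge2$ (with arbitrary edge lengths) and $\pi\colon\widetilde\Gamma\to\Gamma$ the quotient by the antipodal involution. Then \[ P(\Gamma,\pi) = P^0 \sqcup P^1 . \]
   Context: Divisors on metric graphs. $\mathrm{PL}(\Gamma)$ is the set of continuous piecewise linear functions with integer slopes on $\Gamma$; $\mathrm{ord}_p(\varphi)$ is the sum of the incoming slopes of $\varphi$ at $p$, $\mathrm{div}(\varphi)=\sum_p \mathrm{ord}_p(\varphi)\,p$; divisors are linearly equivalent if they differ by some $\mathrm{div}(\varphi)$; $\mathrm{Pic}(\Gamma)$ is the group of classes. $K_\Gamma=\sum_p(\mathrm{val}(p)-2)p$. Loop of loops. For $g\ge 2$, a loop of loops of genus $g$ is a metric graph $\Gamma$ with vertices $v_j,w_j$ ($j\in\mathbb Z/(g-1)\mathbb Z$), with two edges joining $v_j$ to $w_j$ (forming the loop $\gamma_j$) and one edge $\beta_j$ joining $w_{j-1}$ to $v_j$; edge lengths are arbitrary positive reals. $\ell(\gamma_j)$ is the total length of $\gamma_j$; $\ell(v_j,w_j)$ is the length of a fixed one of its two edges, and $\gamma_j$ is oriented so that this edge is traversed from $v_j$ to $w_j$. The cover. $\widetilde\Gamma$ is the loop of loops of genus $2g-1$ (indices $j\in\mathbb Z/(2g-2)\mathbb Z$) with $\ell(\beta_j)=\ell(\beta_{g-1+j})$, $\ell(\gamma_j)=\ell(\gamma_{g-1+j})$, $\ell(v_j,w_j)=\ell(v_{g-1+j},w_{g-1+j})$ whose quotient by the antipodal involution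 $p\mapsto\overline p$ (shifting indices by $g-1$) is $\Gamma$; $\pi$ is the quotient map. $\mathrm{Nm}_\pi(\sum a_pp)=\sum a_p\pi(p)$ and $P(\Gamma,\pi)=\{[D]\in\mathrm{Pic}(\widetilde\Gamma)\mid\mathrm{Nm}_\pi[D]=[K_\Gamma]\}$. Coordinates. For $\xi\in\mathbb R$, $\langle\xi\rangle_j\in\gamma_j\subset\widetilde\Gamma$ is the point reached from $w_j$ by travelling signed distance $\xi\,\ell(v_j,w_j)$ in the direction of the orientation; it depends only on $\xi$ modulo $\ell(\gamma_j)/\ell(v_j,w_j)$, and $w_j=\langle0\rangle_j$, $v_j=\langle-1\rangle_j$. Fix a point $p_0$ in the interior of the edge $\beta_1$ of $\widetilde\Gamma$. Let $\widehat{\mathbb T}^0$ be the set of effective divisors $D=\sum_{j=1}^{2g-2}\langle\xi_j(D)\rangle_j$ of degree $2g-2$ having exactly one point on each loop $\gamma_j$, and $\widehat{\mathbb T}^1=\{D-p_0+\overline p_0\mid D\in\widehat{\mathbb T}^0\}$, with $\xi_j(D-p_0+\overline p_0):=\xi_j(D)$. For $r\in\{0,1\}$, $P^r$ is the set of linear equivalence classes of divisors $D\in\widehat{\mathbb T}^r$ such that $\xi_{g-1+j}(D)=-1-\xi_j(D)$ for all $j$ (equality modulo $\ell(\gamma_j)/\ell(v_j,w_j)$). $\sqcup$ denotes disjoint union. *)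

(* Defs.v *)
From HB Require Import structures.
From mathcomp Require Import all_boot all_order all_algebra.
From mathcomp Require Import all_classical all_reals all_analysis.
From mathcomp Require Import ring lra.
From mathcomp Require Import freeg.

Set Implicit Arguments.
Unset Strict Implicit.
Unset Printing Implicit Defensive.

Import Order.TTheory GRing.Theory Num.Theory.
Import numFieldNormedType.Exports.

Local Open Scope classical_set_scope.
Local Open Scope ring_scope.
Local Open Scope quotient_scope.

Record metric_graph (R : realType) := MetricGraph {
  vertex : finType;
  edge : finType;
  src : edge -> vertex;
  tgt : edge -> vertex;
  len : edge -> R;
  len_gt0 : forall e, 0 < len e }.

Arguments vertex {R}.
Arguments edge {R}.

(* A point is a vertex, or an edge e together with a parameter t in the open
   interval ]0, len e[, the distance from src e along e. *)
Definition gpoint (R : realType) (G : metric_graph R) : choiceType :=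
  (vertex G + {x : edge G * R | 0 < x.2 < len x.1})%type.

Section Points.
Context (R : realType) (G : metric_graph R).

Definition vpt (v : vertex G) : gpoint G := inl v.

(* The isometric parametrization of the closed edge e by [0, len e]. *)
Definition ept (e : edge G) (t : R) : gpoint G :=
  match insub (e, t) : option {x : edge G * R | 0 < x.2 < len x.1} with
  | Some x => inr x
  | None => if t <= 0 then vpt (src e) else vpt (tgt e)
  end.

Definition edge_interior (e : edge G) : set (gpoint G) :=
  [set p | exists2 t, 0 < t < len e & p = ept e t].

Definition valence (v : vertex G) : nat :=
  #|[pred e | src e == v]| + #|[pred e | tgt e == v]|.

End Points.

Definition map_point (R : realType) (G H : metric_graph R)
    (fv : vertex G -> vertex H) (fe : edge G -> edge H) (p : gpoint G) : gpoint H :=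
  match p with
  | inl v => vpt (fv v)
  | inr x => ept (fe (val x).1) (val x).2
  end.

Section PiecewiseLinear.
Context (R : realType).

Definition int_affine_on (f : R -> R) (a b : R) :=
  exists m : int, forall t, a <= t <= b -> f t = f a + m%:~R * (t - a).

(* Continuous piecewise linear with integer slopes on [0, l]: for a finite list
   s of break points, f is affine on every closed subinterval with no break
   point in its interior.  Continuity follows, since consecutive pieces share
   their end points. *)
Definition int_pwlinear (l : R) (f : R -> R) :=
  exists s : seq R, forall a b, 0 <= a -> a <= b -> b <= l ->
    (forall x, x \in s -> ~~ (a < x < b)) -> int_affine_on f a b.

(* u h stands for the value of a function at distance h from a point p along
   some tangent direction; the incoming slope is the slope towards p. *)
Definition has_incoming_slope (u : R -> R) (m : int) :=
  \forall h \near 0^'+, u h = u 0 - m%:~R * h.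

Definition incoming_slope (u : R -> R) : int := xget 0 (has_incoming_slope u).

End PiecewiseLinear.

Section Divisors.
Context (R : realType) (G : metric_graph R).

(* On a union of closed edges glued at vertices, continuity may be checked on
   each closed edge. *)
Definition PL (phi : gpoint G -> R) :=
  forall e : edge G, int_pwlinear (len e) (fun t => phi (ept e t)).

Definition ord_at (phi : gpoint G -> R) (p : gpoint G) : int :=
  match p with
  | inl v =>
      \sum_(e | src e == v) incoming_slope (fun h => phi (ept e h)) +
      \sum_(e | tgt e == v) incoming_slope (fun h => phi (ept e (len e - h)))
  | inr x => let: (e, t) := val x in
      incoming_slope (fun h => phi (ept e (t + h))) +
      incoming_slope (fun h => phi (ept e (t - h)))
  end.

Definition divisor := {freeg (gpoint G)}.

(* D = div(phi) is stated coefficientwise. *)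
Definition principal : {pred divisor} :=
  [pred D : divisor | `[< exists2 phi, PL phi &
                          forall p, coeff p D = ord_at phi p >]].

(* Interior points of edges have valence 2, hence do not contribute. *)
Definition canonical_divisor : divisor :=
  \sum_(v : vertex G) << (valence v)%:Z - 2 *g vpt v >>.

End Divisors.

Section PrincipalSubgroup.
Context (R : realType).
Implicit Types (f u : R -> R) (l t : R).

Lemma int_affineB f1 f2 a b :
  int_affine_on f1 a b -> int_affine_on f2 a b ->
  int_affine_on (fun t => f1 t - f2 t) a b.
Proof.
move=> [m1 h1] [m2 h2]; exists (m1 - m2) => t ht.
by rewrite h1 // h2 // intrB; ring.
Qed.

Lemma int_pwlinearB l f1 f2 :
  int_pwlinear l f1 -> int_pwlinear l f2 ->
  int_pwlinear l (fun t => f1 t - f2 t).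
Proof.
move=> [s1 h1] [s2 h2]; exists (s1 ++ s2) => a b a0 ab bl hs.
have H1 : int_affine_on f1 a b by apply: h1 => // x xs; apply: hs; rewrite mem_cat xs.
have H2 : int_affine_on f2 a b.
  by apply: h2 => // x xs; apply: hs; rewrite mem_cat xs orbT.
exact: int_affineB H1 H2.
Qed.

Lemma has_incoming_slope_uniq u m1 m2 :
  has_incoming_slope u m1 -> has_incoming_slope u m2 -> m1 = m2.
Proof.
move=> h1 h2; have h3 : \forall h \near 0^'+, 0 < h :> R.
  exact: nbhs_right_gt.
have [h [[e1 e2] h0]] : exists h, (u h = u 0 - m1%:~R * h /\ u h = u 0 - m2%:~R * h) /\ 0 < h.
  apply: (@filter_ex _ (0^'+ : set_system R)).
  by apply: filterI => //; apply: filterI.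
have /eqP : m1%:~R * h = m2%:~R * h by lra.
by rewrite -subr_eq0 -mulrBl mulf_eq0 (gt_eqF h0) orbF subr_eq0 eqr_int => /eqP.
Qed.

Lemma incoming_slopeE u m : has_incoming_slope u m -> incoming_slope u = m.
Proof.
move=> h; apply: (has_incoming_slope_uniq _ h).
by apply: (@xgetPex _ 0 (has_incoming_slope u)); exists m.
Qed.

Lemma incoming_slopeB u1 u2 :
  (exists m, has_incoming_slope u1 m) -> (exists m, has_incoming_slope u2 m) ->
  incoming_slope (fun h => u1 h - u2 h) = incoming_slope u1 - incoming_slope u2.
Proof.
move=> [m1 h1] [m2 h2]; rewrite (incoming_slopeE h1) (incoming_slopeE h2).
apply: incoming_slopeE; rewrite /has_incoming_slope.
near=> h.
have -> : u1 h = u1 0 - m1%:~R * h by near: h.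
have -> : u2 h = u2 0 - m2%:~R * h by near: h.
by rewrite intrB; ring.
Unshelve. all: by end_near.
Qed.

Lemma right_gap (s : seq R) t l : t < l ->
  exists b, [/\ t < b, b <= l & forall x, x \in s -> ~~ (t < x < b)].
Proof.
move=> tl; elim: s => [|y s [b [tb bl hb]]]; first by exists l.
have [ty|yt] := ltP t y; last first.
  exists b; split=> // x; rewrite inE => /orP[/eqP ->|/hb //].
  by rewrite ltNge yt.
exists (Num.min b y); split; first by rewrite lt_min tb.
  by rewrite ge_min bl.
move=> x; rewrite inE => /orP[/eqP ->|/hb]; rewrite lt_min; first by rewrite ltxx !andbF.
by apply: contra => /and3P[-> ->].
Qed.

Lemma int_pwlinear_right l f t : int_pwlinear l f -> 0 <= t < l ->
  exists m, has_incoming_slope (fun h => f (t + h)) m.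
Proof.
move=> [s hs] /andP[t0 tl]; have [b [tb bl hb]] := right_gap s tl.
have [m hm] := hs t b t0 (ltW tb) bl hb.
exists (- m); rewrite /has_incoming_slope addr0; near=> h.
have h0 : 0 < h by [].
have hb' : h < b - t by near: h; apply: nbhs_right_lt; rewrite subr_gt0.
rewrite hm; last by apply/andP; split; lra.
by rewrite intrN; ring.
Unshelve. all: by end_near.
Qed.

Lemma int_pwlinear_rev l f : int_pwlinear l f ->
  int_pwlinear l (fun t => f (l - t)).
Proof.
move=> [s hs]; exists [seq l - x | x <- s] => a b a0 ab bl h.
have [|||x xs|m hm] := hs (l - b) (l - a); [lra|lra|lra| |].
  have := h (l - x) (map_f _ xs); apply: contra => /andP[h1 h2].
  by apply/andP; split; lra.
exists (- m) => t /andP[t1 t2].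
rewrite hm; last by apply/andP; split; lra.
rewrite [f (l - a)]hm; last by apply/andP; split; lra.
by rewrite intrN; ring.
Qed.

Lemma int_pwlinear_left l f t : int_pwlinear l f -> 0 < t <= l ->
  exists m, has_incoming_slope (fun h => f (t - h)) m.
Proof.
move=> /int_pwlinear_rev hf /andP[t0 tl].
have [|m hm] := int_pwlinear_right (t := l - t) hf; first by apply/andP; split; lra.
exists m; move: hm; rewrite /has_incoming_slope.
have E h : l - (l - t + h) = t - h by ring.
by rewrite E; apply: filterS => h; rewrite E.
Qed.

Context (G : metric_graph R).
Implicit Types phi : gpoint G -> R.

Lemma PL_B phi psi : PL phi -> PL psi -> PL (fun p => phi p - psi p).
Proof. by move=> h1 h2 e; apply: int_pwlinearB (h1 e) (h2 e). Qed.

Lemma ord_atB phi psi p : PL phi -> PL psi ->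
  ord_at (fun p => phi p - psi p) p = ord_at phi p - ord_at psi p.
Proof.
move=> h1 h2.
have Hr e t : 0 <= t < len e ->
    incoming_slope (fun h => phi (ept e (t + h)) - psi (ept e (t + h))) =
    incoming_slope (fun h => phi (ept e (t + h))) -
    incoming_slope (fun h => psi (ept e (t + h))).
  by move=> ht; apply: incoming_slopeB;
    [apply: (int_pwlinear_right (h1 e))|apply: (int_pwlinear_right (h2 e))].
have Hl e t : 0 < t <= len e ->
    incoming_slope (fun h => phi (ept e (t - h)) - psi (ept e (t - h))) =
    incoming_slope (fun h => phi (ept e (t - h))) -
    incoming_slope (fun h => psi (ept e (t - h))).
  by move=> ht; apply: incoming_slopeB;
    [apply: (int_pwlinear_left (h1 e))|apply: (int_pwlinear_left (h2 e))].
case: p => [v|[[e t] /= /andP[t0 tl]]] /=.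
  have E0 (f : gpoint G -> R) e :
      incoming_slope (fun h => f (ept e h)) = incoming_slope (fun h => f (ept e (0 + h))).
    by congr incoming_slope; apply/funext => h; rewrite add0r.
  rewrite opprD addrACA -!sumrB; congr (_ + _); apply: eq_bigr => e _.
    rewrite !E0 -Hr ?lexx ?len_gt0 //.
    by congr incoming_slope; apply/funext => h; rewrite add0r.
  by rewrite Hl ?lexx ?len_gt0.
by rewrite Hr ?Hl ?(ltW t0) ?(ltW tl) ?t0 ?tl // opprD addrACA.
Qed.

Lemma principal_zmod_closed : zmod_closed (@principal R G).
Proof.
split.
  apply/asboolP; exists (fun=> 0).
    by move=> e; exists [::] => a b _ _ _ _; exists 0 => t _; rewrite mul0r addr0.
  have H0 : @incoming_slope R (fun=> 0) = 0.
    by apply: incoming_slopeE; apply: nearW => h; rewrite mul0r subr0.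
  move=> p; rewrite coeff0; case: p => [v|[[e t] ?]] /=; rewrite ?H0 ?addr0 //.
  by rewrite !big1.
move=> D1 D2 /asboolP[f1 P1 E1] /asboolP[f2 P2 E2]; apply/asboolP.
exists (fun p => f1 p - f2 p); first exact: PL_B.
by move=> p; rewrite coeffB E1 E2 ord_atB.
Qed.

HB.instance Definition _ :=
  GRing.isZmodClosed.Build (divisor G) (@principal R G) principal_zmod_closed.

End PrincipalSubgroup.

Definition Pic (R : realType) (G : metric_graph R) : zmodType :=
  Quotient.quot (@principal R G).

Definition divclass (R : realType) (G : metric_graph R) (D : divisor G) : Pic G :=
  \pi_(Pic G) D.

Definition Nm (R : realType) (G H : metric_graph R) (f : gpoint G -> gpoint H)
  (D : divisor G) : divisor H := fglift (fun p => << f p >>) D.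

(* The underlying graph of a loop of n loops, indices j in Z/nZ, with
   vertices v_j, w_j; edges Evw j and Ewv j joining v_j and w_j, and Ebeta j
   joining w_(j-1) to v_j. *)
Variant ll_vertex (n : nat) := Vv of 'I_n | Vw of 'I_n.
Variant ll_edge (n : nat) := Evw of 'I_n | Ewv of 'I_n | Ebeta of 'I_n.

Section LoopFinite.
Context (n : nat).

Definition ll_vertex_to (v : ll_vertex n) : 'I_n + 'I_n :=
  match v with Vv j => inl j | Vw j => inr j end.
Definition ll_vertex_of (s : 'I_n + 'I_n) : ll_vertex n :=
  match s with inl j => Vv j | inr j => Vw j end.
Lemma ll_vertex_toK : cancel ll_vertex_to ll_vertex_of.
Proof. by case. Qed.
HB.instance Definition _ := Finite.copy (ll_vertex n) (can_type ll_vertex_toK).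

Definition ll_edge_to (e : ll_edge n) : 'I_n + 'I_n + 'I_n :=
  match e with Evw j => inl (inl j) | Ewv j => inl (inr j) | Ebeta j => inr j end.
Definition ll_edge_of (s : 'I_n + 'I_n + 'I_n) : ll_edge n :=
  match s with inl (inl j) => Evw j | inl (inr j) => Ewv j | inr j => Ebeta j end.
Lemma ll_edge_toK : cancel ll_edge_to ll_edge_of.
Proof. by case. Qed.
HB.instance Definition _ := Finite.copy (ll_edge n) (can_type ll_edge_toK).

End LoopFinite.

Definition ll_vertex_map n m (f : 'I_n -> 'I_m) (v : ll_vertex n) : ll_vertex m :=
  match v with Vv j => Vv (f j) | Vw j => Vw (f j) end.

Definition ll_edge_map n m (f : 'I_n -> 'I_m) (e : ll_edge n) : ll_edge m :=
  match e with
  | Evw j => Evw (f j) | Ewv j => Ewv (f j) | Ebeta j => Ebeta (f j)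
  end.

(* The lengths of a loop of n loops (of genus n + 1).  Evw j is the fixed edge
   between v_j and w_j, so len_vw j is the length l(v_j, w_j). *)
Record loop_of_loops (R : realType) (n : nat) := LoopOfLoops {
  len_vw : 'I_n -> R;
  len_wv : 'I_n -> R;
  len_beta : 'I_n -> R;
  len_vw_gt0 : forall j, 0 < len_vw j;
  len_wv_gt0 : forall j, 0 < len_wv j;
  len_beta_gt0 : forall j, 0 < len_beta j }.

Section LoopOfLoops.
Context (R : realType) (n : nat) (G : loop_of_loops R n).

(* Evw j and Ewv j are both directed along the orientation of the loop j, which
   traverses Evw j from v_j to w_j. *)
Definition ll_src (e : ll_edge n) : ll_vertex n :=
  match e with Evw j => Vv j | Ewv j => Vw j | Ebeta j => Vw (ord_pred j) end.

Definition ll_tgt (e : ll_edge n) : ll_vertex n :=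
  match e with Evw j => Vw j | Ewv j => Vv j | Ebeta j => Vv j end.

Definition ll_len (e : ll_edge n) : R :=
  match e with
  | Evw j => len_vw G j | Ewv j => len_wv G j | Ebeta j => len_beta G j
  end.

Lemma ll_len_gt0 e : 0 < ll_len e.
Proof.
by case: e => j; [apply: len_vw_gt0|apply: len_wv_gt0|apply: len_beta_gt0].
Qed.

Definition ll_graph : metric_graph R := MetricGraph ll_src ll_tgt ll_len_gt0.

Definition loop_len (j : 'I_n) : R := len_vw G j + len_wv G j.

(* <xi>_j: starting from w_j, the orientation first follows Ewv j to v_j and
   then Evw j back to w_j. *)
Definition loop_point (j : 'I_n) (xi : R) : gpoint ll_graph :=
  let d := xi * len_vw G j in
  let r := d - (Num.floor (d / loop_len j))%:~R * loop_len j in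
  if r < len_wv G j then @ept R ll_graph (Ewv j) r
  else @ept R ll_graph (Evw j) (r - len_wv G j).

Definition eq_coord (j : 'I_n) (xi eta : R) :=
  exists k : int, xi = eta + k%:~R * (loop_len j / len_vw G j).

End LoopOfLoops.

Coercion ll_graph : loop_of_loops >-> metric_graph.

Section DoubleCover.
Context (R : realType) (n : nat).

Lemma ll_red_subproof (j : 'I_(2 * n)) : (j %% n < n)%N.
Proof. by rewrite ltn_mod; case: n j => [|//] [[]]. Qed.

Definition ll_red (j : 'I_(2 * n)) : 'I_n := Ordinal (ll_red_subproof j).

(* j |-> j + n in Z/(2n)Z *)
Definition ll_shift (j : 'I_(2 * n)) : 'I_(2 * n) := iter n (@ordS _) j.

Context (G : loop_of_loops R n).

Definition double_cover : loop_of_loops R (2 * n) :=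
  @LoopOfLoops R (2 * n)
    (len_vw G \o ll_red) (len_wv G \o ll_red) (len_beta G \o ll_red)
    (fun j => len_vw_gt0 G (ll_red j)) (fun j => len_wv_gt0 G (ll_red j))
    (fun j => len_beta_gt0 G (ll_red j)).

Definition antipode : gpoint double_cover -> gpoint double_cover :=
  @map_point R double_cover double_cover
    (ll_vertex_map ll_shift) (ll_edge_map ll_shift).

Definition cover_map : gpoint double_cover -> gpoint G :=
  @map_point R double_cover G (ll_vertex_map ll_red) (ll_edge_map ll_red).

(* Nm on classes is induced by Nm on divisors: Nm [D] = [Nm D]. *)
Definition prym : set (Pic double_cover) :=
  [set divclass D | D in
     [set D | divclass (Nm cover_map D) = divclass (canonical_divisor G)]].

(* The divisor of \hat T^r with coordinates xi_j modulo l(gamma_j)/l(v_j, w_j);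
   r = false, true stands for r = 0, 1. *)
Definition That_divisor (p0 : gpoint double_cover) (r : bool)
    (xi : 'I_(2 * n) -> R) : divisor double_cover :=
  \sum_j << loop_point double_cover j (xi j) >>
  + (if r then - << p0 >> + << antipode p0 >> else 0).

Definition prym_part (p0 : gpoint double_cover) (r : bool) :
    set (Pic double_cover) :=
  [set divclass (That_divisor p0 r xi) | xi in
     [set xi | forall j, eq_coord double_cover (ll_shift j)
                           (xi (ll_shift j)) (- 1 - xi j)]].

End DoubleCover.

Arguments prym {R n} G.

(* Main.v *)
(* For a divisor D of the cover, write D^- for its antipode.

   If Nm D is equivalent to K, say Nm D = K + div phi, then normalizing phi to
   vanish at the vertex w_(g-2) and extending it by 0 from one sheet of the cover
   to the other gives psi with Nm (div psi) = div phi.  Taking D0 with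
   coordinates 0 and -1 on the two sheets, D - div psi - D0 has norm 0, hence is
   of the form F - F^-.  So it is enough to see that the union of P^0 and P^1 is
   stable under adding p - p^-.  Moving p along a bridge does not change the
   class of p - p^-; moving p from <b> to <a> on a loop amounts to replacing xi_j
   by xi_j + a - b on that loop and making the symmetric change on the antipodal
   one.  Hence p may be moved to p_0 or to its antipode, which exchanges P^0 and P^1.

   Conversely, <xi> + <-1-xi> is equivalent to v + w on each loop of Gamma, so the
   norm of both parts is K.  The parts are disjoint because F - F^- = div phi
   forces deg F to be even: phi + phi^- is constant, so the total flux of phi out
   of one sheet is twice an integer slope. *)
Require Import Defs.
From HB Require Import structures.
From mathcomp Require Import all_boot all_order all_algebra.
From mathcomp Require Import all_classical all_reals all_analysis.
From mathcomp Require Import ring lra zify.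
From mathcomp Require Import freeg.

Set Implicit Arguments.
Unset Strict Implicit.
Unset Printing Implicit Defensive.

Import Order.TTheory GRing.Theory Num.Theory.
Import numFieldNormedType.Exports.

Local Open Scope classical_set_scope.
Local Open Scope ring_scope.

(** * Additive maps on free abelian groups, and the norm *)

Section FreeAbelianGroup.
Context (K : choiceType).
Implicit Types D : {freeg K}.

(** Every divisor is obtained from points by repeated subtraction, so an additive identity has to be
    checked on points only. *)
Lemma freeg_zmod_ind (P : {freeg K} -> Prop) :
  P 0 -> (forall D1 D2, P D1 -> P D2 -> P (D1 - D2)) ->
  (forall k, P << k >>) -> forall D, P D.
Proof.
move=> P0 PB PU.
have PN D : P D -> P (- D) by move=> PD; rewrite -sub0r; apply: PB.
have PD D1 D2 : P D1 -> P D2 -> P (D1 + D2).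
  by move=> P1 P2; rewrite -[D2]opprK; apply: PB => //; apply: PN.
have PMn D n : P D -> P (D *+ n).
  by move=> PD1; elim: n => [|n IH]; rewrite ?mulr0n // mulrS; apply: PD.
elim/freeg_ind_dom0 => // k x D _ _; apply: PD.
rewrite -[k]intz -freegU_mulz; case: k => n; first exact: PMn.
by rewrite NegzE mulrNz; apply/PN/PMn.
Qed.

(** Evaluation of the function [f] on a divisor, with values in any abelian group. *)
Definition pairing (M : zmodType) (f : K -> M) (D : {freeg K}) : M :=
  fglift (f : K -> zmodule M) D.

Lemma pairing_is_additive (M : zmodType) (f : K -> M) : additive (pairing f).
Proof. exact: (lift_is_additive (f : K -> zmodule M)). Qed.

HB.instance Definition _ (M : zmodType) (f : K -> M) :=
  GRing.isAdditive.Build {freeg K} M (pairing f) (pairing_is_additive f).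

Lemma pairingU (M : zmodType) (f : K -> M) k : pairing f << k >> = f k.
Proof. by rewrite /pairing liftU scale1r. Qed.

Lemma coeff_point (k l : K) : coeff l << k >> = (k == l)%:R :> int.
Proof. by rewrite coeffU mul1r. Qed.

End FreeAbelianGroup.

Section Nm.
Context (R : realType) (G H : metric_graph R) (f : gpoint G -> gpoint H).

Lemma Nm_is_additive : additive (Nm f).
Proof. exact: lift_is_additive. Qed.

HB.instance Definition _ :=
  GRing.isAdditive.Build (divisor G) (divisor H) (Nm f) Nm_is_additive.

Lemma NmU p : Nm f << p >> = << f p >>.
Proof. by rewrite /Nm liftU scale1r. Qed.

End Nm.

Lemma eq_Nm (R : realType) (G H : metric_graph R) (f g : gpoint G -> gpoint H) :
  f =1 g -> Nm f =1 Nm g.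
Proof. by move=> /funext ->. Qed.

Lemma Nm_comp (R : realType) (G H I : metric_graph R) (f : gpoint G -> gpoint H)
  (h : gpoint H -> gpoint I) D : Nm h (Nm f D) = Nm (h \o f) D.
Proof.
move: D; apply: freeg_zmod_ind => [|D1 D2 e1 e2|p]; first by rewrite !raddf0.
  by rewrite !raddfB /= e1 e2.
by rewrite !NmU.
Qed.

Lemma Nm_id (R : realType) (G : metric_graph R) (D : divisor G) : Nm id D = D.
Proof.
move: D; apply: freeg_zmod_ind => [|D1 D2 e1 e2|p]; first by rewrite !raddf0.
  by rewrite !raddfB /= e1 e2.
by rewrite !NmU.
Qed.

(** * Closed edges and maps between metric graphs *)

Section EdgePoints.
Context (R : realType) (G : metric_graph R).
Implicit Types (e : edge G) (t : R).

Lemma ept0 e : ept e 0 = vpt (src e).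
Proof. by rewrite /ept insubF ?lexx //= ltxx. Qed.

Lemma ept_len e : ept e (len e) = vpt (tgt e).
Proof. by rewrite /ept insubF /= ?ltxx ?andbF // leNgt len_gt0. Qed.

Lemma ept_inr e t (h : 0 < (e, t).2 < len (e, t).1) : ept e t = inr (exist _ (e, t) h).
Proof. by rewrite /ept (insubT (fun x : edge G * R => 0 < x.2 < len x.1)). Qed.

(** [ept] branches on whether the parameter is interior; a statement along a closed edge is
    therefore checked at the two ends and on the interior summand. *)
Lemma edge_param_ind (P : R -> gpoint G -> Prop) e :
  P 0 (vpt (src e)) -> P (len e) (vpt (tgt e)) ->
  (forall t (h : 0 < (e, t).2 < len (e, t).1), P t (inr (exist _ (e, t) h))) ->
  forall t, 0 <= t <= len e -> P t (ept e t).
Proof.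
move=> P0 Pl Pin t /andP[]; rewrite le_eqVlt => /orP[/eqP <-|t0]; first by rewrite ept0.
rewrite le_eqVlt => /orP[/eqP ->|tl]; first by rewrite ept_len.
have h : 0 < (e, t).2 < len (e, t).1 by rewrite /= t0 tl.
by rewrite (ept_inr h).
Qed.

Lemma gpoint_ind (P : gpoint G -> Prop) :
  (forall v, P (vpt v)) ->
  (forall e t, 0 <= t <= len e -> 0 < t < len e -> P (ept e t)) -> forall p, P p.
Proof.
move=> hv he [v|[[e t] h]]; first exact: hv.
rewrite -ept_inr; apply: he => //.
by case/andP: h => /= /ltW -> /ltW ->.
Qed.

End EdgePoints.

Section MapPoint.
Context (R : realType) (G H : metric_graph R).
Context (fv : vertex G -> vertex H) (fe : edge G -> edge H).
Hypothesis src_fe : forall e, src (fe e) = fv (src e).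
Hypothesis tgt_fe : forall e, tgt (fe e) = fv (tgt e).
Hypothesis len_fe : forall e, len (fe e) = len e.

Lemma map_point_ept e t : 0 <= t <= len e ->
  map_point fv fe (ept e t) = ept (fe e) t.
Proof.
move: t; apply: (edge_param_ind (P := fun t p => map_point fv fe p = ept (fe e) t)) => //=.
  by rewrite ept0 src_fe.
by rewrite -len_fe ept_len tgt_fe.
Qed.

End MapPoint.

(** * Piecewise linear functions on an edge as sums of hinges *)

Section EdgeChips.
Context (R : realType) (G : metric_graph R).
Implicit Types (e : edge G) (l : seq (int * R)) (D : divisor G) (V : vertex G -> R).

(* The hinge t |-> max(0, t - a) on the edge e has divisor (tgt e) - (ept e a);
   affine functions are covered by a = 0. *)
Definition hinge_sum l (t : R) : R :=
  \sum_(k <- l) k.1%:~R * Num.max 0 (t - k.2).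

Definition on_edge e l := all (fun k : int * R => 0 <= k.2 <= len e) l.

Definition edge_chips e l : divisor G :=
  \sum_(k <- l) (<< vpt (tgt e) >> - << ept e k.2 >>) *~ k.1.

Lemma hinge_sum0 e l : on_edge e l -> hinge_sum l 0 = 0.
Proof.
move=> /allP h; rewrite /hinge_sum big_seq big1 // => k /h /andP[k0 _].
by rewrite sub0r max_l ?mulr0 // oppr_le0.
Qed.

Lemma hinge_sum_len e l : on_edge e l ->
  hinge_sum l (len e) = \sum_(k <- l) k.1%:~R * (len e - k.2).
Proof.
move=> /allP h; rewrite /hinge_sum !big_seq; apply: eq_bigr => k /h /andP[_ kl].
by rewrite max_r // subr_ge0.
Qed.

(** The pieces are read from left to right, by induction on the sorted break points; [a0] is the
    left end of the part still to be treated. *)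
Lemma int_pwlinear_affine (len a0 : R) (s : seq R) (f : R -> R) :
  0 <= a0 -> sorted <=%R s -> (forall x, x \in s -> a0 <= x) ->
  (forall a b, a0 <= a -> a <= b -> b <= len ->
    (forall x, x \in s -> ~~ (a < x < b)) -> int_affine_on f a b) ->
  exists l, [/\ all (fun k : int * R => a0 <= k.2 <= len) l &
    forall t, a0 <= t <= len -> f t = f a0 + hinge_sum l t].
Proof.
elim: s a0 => [|x s IH] a0 a00 srt hs aff; case: (leP a0 len) => [al|la]; try by
  exists [::]; split => // t /andP[h1 h2]; have := le_lt_trans (le_trans h1 h2) la; rewrite ltxx.
  have [|m hm] := aff a0 len (lexx _) al (lexx _); first by [].
  exists [:: (m, a0)]; split; first by rewrite /= lexx al.
  by move=> t ht; rewrite hm // /hinge_sum big_seq1 max_r // subr_ge0; case/andP: ht.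
(* If the next break point lies beyond [len], so do all later ones, and a single affine piece is
   left. *)
have [xl|lx] := leP x len; last first.
  have [|m hm] := aff a0 len (lexx _) al (lexx _).
    move=> y ys; have xy : x <= y.
      move: ys; rewrite inE => /orP[/eqP -> //|ys].
      by move: srt; rewrite /= (path_sortedE le_trans) => /andP[/allP h _]; apply: h.
    by rewrite negb_and -!leNgt (le_trans (ltW lx) xy) orbT.
  exists [:: (m, a0)]; split; first by rewrite /= lexx al.
  by move=> t ht; rewrite hm // /hinge_sum big_seq1 max_r // subr_ge0; case/andP: ht.
have a0x : a0 <= x by apply: hs; rewrite mem_head.
have xs y : y \in s -> x <= y.
  by move=> ys; move: srt; rewrite /= (path_sortedE le_trans) => /andP[/allP h _]; apply: h.
have [||||l [lok hl]] := IH x.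
- exact: le_trans a0x.
- exact: path_sorted srt.
- exact: xs.
- move=> a b xa ab bl hb; apply: aff => //; first exact: le_trans xa.
  move=> y; rewrite inE => /orP[/eqP ->|/hb //].
  by rewrite ltNge xa.
have [|m hm] := aff a0 x (lexx _) a0x xl.
  by move=> y; rewrite inE negb_and -!leNgt => /orP[/eqP ->|/xs ->]; rewrite ?lexx orbT.
(* The slope [m] of the first piece is switched off at [x], where the hinges of the induction
   hypothesis take over. *)
exists ((m, a0) :: (- m, x) :: l); split.
  rewrite /= lexx al a0x xl /=; apply: sub_all lok => k /andP[k1 k2].
  by rewrite (le_trans a0x k1).
move=> t /andP[t1 t2]; rewrite /hinge_sum !big_cons /= -/(hinge_sum l t).
rewrite [Num.max 0 (t - a0)]max_r ?subr_ge0 //.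
have [tx|/ltW xt] := leP t x.
  rewrite hm ?t1 // [Num.max _ _]max_l ?subr_le0 //.
  suff -> : hinge_sum l t = 0 by ring.
  rewrite /hinge_sum big_seq big1 // => k /(allP lok) /andP[k1 _].
  by rewrite max_l ?mulr0 // subr_le0 (le_trans tx).
rewrite hl ?xt // [Num.max _ _]max_r ?subr_ge0 // (hm x) ?a0x ?lexx // intrN.
by ring.
Qed.

Lemma int_pwlinear_hinge e (f : R -> R) : int_pwlinear (len e) f ->
  exists2 l, on_edge e l & forall t, 0 <= t <= len e -> f t = f 0 + hinge_sum l t.
Proof.
(* Negative break points never lie inside a subinterval of the edge; without them the induction can
   start at 0. *)
move=> [s hs]; pose s' := sort <=%R [seq x <- s | 0 <= x].
have [|||l [lok hl]] := @int_pwlinear_affine (len e) 0 s' f (lexx _).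
- by apply: sort_sorted => x y; apply: le_total.
- by move=> x; rewrite mem_sort mem_filter => /andP[].
- move=> a b a0 ab bl hb; apply: hs => // x xs.
  have [x0|x0] := leP 0 x; last by rewrite negb_and -leNgt (le_trans (ltW x0)).
  by apply: hb; rewrite mem_sort mem_filter x0.
by exists l.
Qed.

End EdgeChips.

(** * Incoming slopes of sums of hinges *)

Section IncomingSlopes.
Context (R : realType).
Implicit Types (l : seq (int * R)) (t : R).

Lemma has_incoming_slopeD (u1 u2 : R -> R) m1 m2 :
  has_incoming_slope u1 m1 -> has_incoming_slope u2 m2 ->
  has_incoming_slope (fun h => u1 h + u2 h) (m1 + m2).
Proof.
move=> h1 h2; rewrite /has_incoming_slope; near=> h.
have -> : u1 h = u1 0 - m1%:~R * h by near: h.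
have -> : u2 h = u2 0 - m2%:~R * h by near: h.
by rewrite intrD; ring.
Unshelve. all: by end_near.
Qed.

Lemma has_incoming_slope_cst (c : R) : has_incoming_slope (fun=> c) 0.
Proof. by apply: nearW => h; rewrite mul0r subr0. Qed.

Lemma hinge_sum_cons k l t :
  hinge_sum (k :: l) t = k.1%:~R * Num.max 0 (t - k.2) + hinge_sum l t.
Proof. by rewrite /hinge_sum big_cons. Qed.

(** A hinge starting exactly at [t] rises to the right of [t] but is flat to its left: hence the
    weak inequality here and the strict one on the left. The sign appears because slopes are counted
    towards [t]. *)
Lemma hinge_sum_slope_right l t :
  has_incoming_slope (fun h => hinge_sum l (t + h))
    (- \sum_(k <- l | k.2 <= t) k.1).
Proof.
elim: l => [|k l IH].
  by rewrite big_nil oppr0; apply: nearW => h; rewrite /hinge_sum !big_nil mul0r subr0.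
rewrite (_ : (fun h => _) =
    (fun h => k.1%:~R * Num.max 0 (t + h - k.2) + hinge_sum l (t + h))); last first.
  by apply/funext => h; rewrite hinge_sum_cons.
rewrite big_cons (_ : - _ = (if k.2 <= t then - k.1 else 0) +
   - \sum_(j <- l | j.2 <= t) j.1); last by case: ifP => _; rewrite ?opprD ?add0r.
apply: has_incoming_slopeD => //; rewrite /has_incoming_slope addr0.
case: leP => kt; near=> h.
  have h0 : 0 < h by [].
  rewrite !max_r; [by rewrite intrN; ring|lra|lra].
have h0 : h < k.2 - t by near: h; apply: nbhs_right_lt; rewrite subr_gt0.
rewrite !max_l; [by ring|lra|lra].
Unshelve. all: by end_near.
Qed.

Lemma hinge_sum_slope_left l t :
  has_incoming_slope (fun h => hinge_sum l (t - h)) (\sum_(k <- l | k.2 < t) k.1).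
Proof.
elim: l => [|k l IH].
  by rewrite big_nil; apply: nearW => h; rewrite /hinge_sum !big_nil mul0r subr0.
rewrite (_ : (fun h => _) =
    (fun h => k.1%:~R * Num.max 0 (t - h - k.2) + hinge_sum l (t - h))); last first.
  by apply/funext => h; rewrite hinge_sum_cons.
rewrite big_cons (_ : (if _ then _ else _) = (if k.2 < t then k.1 else 0) +
   \sum_(j <- l | j.2 < t) j.1); last by case: ifP => _; rewrite ?add0r.
apply: has_incoming_slopeD => //; rewrite /has_incoming_slope subr0.
case: ltP => kt; near=> h.
  have h0 : h < t - k.2 by near: h; apply: nbhs_right_lt; rewrite subr_gt0.
  rewrite !max_r; [by ring|lra|lra].
have h0 : 0 < h by [].
rewrite !max_l; [by ring|lra|lra].
Unshelve. all: by end_near.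
Qed.

(** The incoming slope depends only on the germ at 0, so a formula valid on the closed edge alone is
    enough to compute it. *)
Lemma eq_incoming_slope (u v : R -> R) (m : int) (b : R) : 0 < b ->
  (forall h, 0 <= h < b -> u h = v h) -> has_incoming_slope v m ->
  incoming_slope u = m.
Proof.
move=> b0 uv hv; apply: incoming_slopeE; rewrite /has_incoming_slope; near=> h.
have h0 : 0 < h by [].
have hb : h < b by near: h; apply: nbhs_right_lt.
rewrite !uv ?lexx ?(ltW h0) //; near: h; exact: hv.
Unshelve. all: by end_near.
Qed.

End IncomingSlopes.

(** * Principal divisors described edge by edge *)

Section PrincipalDivisors.
Context (R : realType) (G : metric_graph R).
Implicit Types (e : edge G) (D : divisor G) (V : vertex G -> R).

Lemma ept_vertex e t v : 0 <= t <= len e ->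
  (ept e t == vpt v) = if t <= 0 then src e == v else (len e <= t) && (tgt e == v).
Proof.
move: t; apply: (edge_param_ind (P := fun t p => (p == vpt v) =
  if t <= 0 then src e == v else (len e <= t) && (tgt e == v))).
- by rewrite lexx.
- by rewrite leNgt len_gt0 lexx.
- by move=> t h; have /andP[/= t0 tl] := h; rewrite leNgt t0 leNgt tl.
Qed.

Lemma ept_interior e e' t t' (h : 0 < (e', t').2 < len (e', t').1) :
  0 <= t <= len e -> (ept e t == inr (exist _ (e', t') h)) = (e == e') && (t == t').
Proof.
move: t; apply: (edge_param_ind (P := fun t p =>
  (p == inr (exist _ (e', t') h)) = (e == e') && (t == t'))).
- by apply/esym/negbTE/negP => /andP[_ /eqP E]; move: h; rewrite -E /= ltxx.
- apply/esym/negbTE/negP => /andP[/eqP E1 /eqP E]; move: h.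
  by rewrite -E -E1 /= ltxx andbF.
- by move=> t h1.
Qed.

Section OrdHinge.
Context (phi : gpoint G -> R) (l : edge G -> seq (int * R)).
Hypothesis l_on : forall e, on_edge e (l e).
Hypothesis phiE : forall e t, 0 <= t <= len e ->
  phi (ept e t) = phi (vpt (src e)) + hinge_sum (l e) t.

Let slope_right e t : 0 <= t < len e ->
  incoming_slope (fun h => phi (ept e (t + h))) = - \sum_(k <- l e | k.2 <= t) k.1.
Proof.
move=> /andP[t0 tl].
apply: (@eq_incoming_slope _ _ _ _ (len e - t)); first by rewrite subr_gt0.
  by move=> h /andP[h0 hl]; rewrite phiE //; apply/andP; split; lra.
rewrite -[X in has_incoming_slope _ X]add0r; apply: has_incoming_slopeD.
  exact: has_incoming_slope_cst.
exact: hinge_sum_slope_right.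
Qed.

Let slope_left e t : 0 < t <= len e ->
  incoming_slope (fun h => phi (ept e (t - h))) = \sum_(k <- l e | k.2 < t) k.1.
Proof.
move=> /andP[t0 tl].
apply: (@eq_incoming_slope _ _ _ _ t); first by [].
  by move=> h /andP[h0 hl]; rewrite phiE //; apply/andP; split; lra.
rewrite -[X in has_incoming_slope _ X]add0r; apply: has_incoming_slopeD.
  exact: has_incoming_slope_cst.
exact: hinge_sum_slope_left.
Qed.

(** At an interior point the right and left slopes of a hinge cancel unless the hinge starts there,
    which leaves its chip of coefficient -1. The two ends of an edge are counted separately, so an
    edge with equal ends is covered too. *)
Lemma ord_at_hinge p : ord_at phi p = coeff p (\sum_e edge_chips e (l e)).
Proof.
rewrite raddf_sum /=; under eq_bigr => e _ do rewrite raddf_sum /=.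
case: p => [v|[[e t] h]] /=.
  rewrite !(big_mkcond (fun e => _ == v)) -big_split /=; apply: eq_bigr => e _.
  have := slope_right (e := e) (t := 0); rewrite lexx len_gt0 => /(_ isT).
  rewrite (_ : (fun h => phi _) = (fun h => phi (ept e h))); last first.
    by apply/funext => h; rewrite add0r.
  move=> ->; rewrite slope_left ?len_gt0 ?lexx //.
  rewrite -sumrN (big_mkcond (fun k => k.2 <= 0)) (big_mkcond (fun k => k.2 < len e)) /=.
  transitivity (\sum_(k <- l e)
     ((if src e == v then (if k.2 <= 0 then - k.1 else 0) else 0) +
      (if tgt e == v then (if k.2 < len e then k.1 else 0) else 0))).
    by rewrite big_split /=; congr (_ + _); case: (_ == v); rewrite ?big1_eq.
  rewrite !big_seq; apply: eq_bigr => k /(allP (l_on e)) hk.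
  rewrite raddfMz mulrzz raddfB /= !coeff_point ept_vertex // (_ : (inl _ == inl v) = (tgt e == v)) //.
  rewrite (leNgt (len e)); case/andP: hk => k0 kl.
  have := len_gt0 e.
  by case: (src e == v); case: (tgt e == v); case: (leP k.2 0); case: (ltP k.2 (len e)) => /= ? ? ?;
   rewrite ?mulr1n ?mulr0n; (ring || (exfalso; lra)).
have /andP[/= t0 tl] := h.
rewrite slope_right ?slope_left ?t0 ?tl ?(ltW t0) ?(ltW tl) //.
rewrite (bigD1 e) //= [X in _ = _ + X]big1 ?addr0; last first.
  move=> e' e'e; rewrite big_seq big1 // => k /(allP (l_on e')) hk.
  rewrite raddfMz mulrzz raddfB /= !coeff_point (ept_interior h hk) (negbTE e'e) /=.
  by rewrite subr0 mul0r.
rewrite -sumrN (big_mkcond (fun k => k.2 <= t)) (big_mkcond (fun k => k.2 < t)) /= -big_split /= !big_seq.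
apply: eq_bigr => k /(allP (l_on e)) hk.
rewrite raddfMz mulrzz raddfB /= !coeff_point (ept_interior h hk) eqxx /=.
by case: (ltgtP k.2 t) => _; rewrite ?mulr1n ?mulr0n; ring.
Qed.

Lemma PL_hinge : PL phi.
Proof.
move=> e; exists [seq k.2 | k <- l e] => a b a0 ab bl hs.
exists (\sum_(k <- l e | k.2 <= a) k.1) => t /andP[ta tb].
rewrite !phiE ?a0 ?(le_trans ab) ?(le_trans a0) ?(le_trans tb) //.
rewrite -addrA; congr (_ + _); apply/eqP; rewrite addrC -subr_eq; apply/eqP.
rewrite /hinge_sum rmorph_sum /= mulr_suml [X in _ = X]big_mkcond /= -sumrB !big_seq.
apply: eq_bigr => k kl; have := hs _ (map_f _ kl); rewrite negb_and -!leNgt.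
case: leP => ka /=.
  by rewrite !max_r ?subr_ge0 ?(le_trans ka) // => _; ring.
move=> bk; rewrite !max_l ?subr_le0 ?(ltW ka) //; first by ring.
exact: le_trans bk.
Qed.

End OrdHinge.

(* The hinge functions of l add up to a function on e with divisor D, vanishing
   at src e and equal to d at tgt e. *)
Definition edge_real e D (d : R) := exists2 l, on_edge e l &
  D = edge_chips e l /\ d = \sum_(k <- l) k.1%:~R * (len e - k.2).

(** A function is recorded by its values [V] at the vertices and by the divisors of its restrictions
    to the edges. Cycles impose no further condition, because all increments come from the same
    [V]. *)
Lemma principalP D : reflect
  (exists V (E : edge G -> divisor G),
     (forall e, edge_real e (E e) (V (tgt e) - V (src e))) /\ D = \sum_e E e)
  (D \in @principal R G).
Proof.
apply: (iffP idP).
  move=> /asboolP[phi phiPL Dphi].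
  have /choice[l hl] : forall e, exists l, on_edge e l /\
     forall t, 0 <= t <= len e -> phi (ept e t) = phi (ept e 0) + hinge_sum l t.
    by move=> e; have [l l1 l2] := int_pwlinear_hinge (phiPL e); exists l.
  exists (fun v => phi (vpt v)), (fun e => edge_chips e (l e)); split=> [e|].
    have [l1 l2] := hl e; exists (l e) => //; split => //.
    rewrite -hinge_sum_len // -ept_len l2 ?lexx ?ltW ?len_gt0 // ept0.
    by rewrite addrAC subrr add0r.
  apply/eqP/freeg_eqP => p; rewrite Dphi; apply: ord_at_hinge => [e|e t ht].
    by have [] := hl e.
  by have [_ l2] := hl e; rewrite l2 // ept0.
move=> [V [E [hE ->]]].
have /choice[l hl] : forall e, exists l, on_edge e l /\ (E e = edge_chips e l /\
    V (tgt e) - V (src e) = \sum_(k <- l) k.1%:~R * (len e - k.2)).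
  by move=> e; have [l l1 l2] := hE e; exists l.
rewrite (eq_bigr (fun e => edge_chips e (l e))); last by move=> e _; have [_ []] := hl e.
(* The hinges on each edge start from the prescribed value at its source; the prescribed increments
   make them end at the value at the target. *)
pose phi (p : gpoint G) := match p with
  | inl v => V v
  | inr x => V (src (val x).1) + hinge_sum (l (val x).1) (val x).2 end.
have l_on e : on_edge e (l e) by have [] := hl e.
have phiE e t : 0 <= t <= len e ->
    phi (ept e t) = phi (vpt (src e)) + hinge_sum (l e) t.
  move: t; apply: (edge_param_ind (P := fun t p => phi p = phi (vpt (src e)) + hinge_sum (l e) t)) => //=.
    by rewrite (hinge_sum0 (l_on e)) addr0.
  by rewrite (hinge_sum_len (l_on e)); have [_ [_ <-]] := hl e; ring.
apply/asboolP; exists phi; first exact: PL_hinge phiE.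
by move=> p; rewrite (ord_at_hinge l_on phiE).
Qed.

End PrincipalDivisors.

Ltac freeg_ring := apply/eqP/freeg_eqP => ?;
  rewrite ?(coeffD, coeffB, coeffN, coeff0, raddfMz, mulrzz); ring.

(** * Pairing functions with the divisors of one edge *)

Section EdgeReal.
Context (R : realType) (G : metric_graph R).
Implicit Types (e : edge G) (D : divisor G) (V : vertex G -> R).

Lemma edge_real0 e : edge_real e 0 0.
Proof. by exists [::]; rewrite /edge_chips ?big_nil. Qed.

Lemma edge_realB e D1 D2 d1 d2 : edge_real e D1 d1 -> edge_real e D2 d2 ->
  edge_real e (D1 - D2) (d1 - d2).
Proof.
move=> [l1 on1 [-> ->]] [l2 on2 [-> ->]].
exists (l1 ++ [seq (- k.1, k.2) | k <- l2]).
  by rewrite /on_edge all_cat all_map; apply/andP.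
rewrite /edge_chips !big_cat /= !big_map -!sumrN; split; congr (_ + _).
  by apply: eq_bigr => k _; rewrite mulrNz.
by apply: eq_bigr => k _; rewrite intrN mulNr.
Qed.

Lemma edge_realN e D d : edge_real e D d -> edge_real e (- D) (- d).
Proof. by rewrite -[- D]sub0r -[- d]sub0r; apply: edge_realB; apply: edge_real0. Qed.

Lemma edge_realD e D1 D2 d1 d2 : edge_real e D1 d1 -> edge_real e D2 d2 ->
  edge_real e (D1 + D2) (d1 + d2).
Proof.
by move=> h1 h2; rewrite -[D2]opprK -[d2]opprK; apply/edge_realB/edge_realN.
Qed.

(** The divisor of each hinge has degree 0, so a function constant on the edge pairs to 0 with
    it. *)
Lemma edge_real_pairing_cst (M : zmodType) (f : gpoint G -> M) e D d :
  (forall t, 0 <= t <= len e -> f (ept e t) = f (vpt (tgt e))) ->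
  edge_real e D d -> pairing f D = 0.
Proof.
move=> hf [l /allP l_on [-> _]]; rewrite /edge_chips raddf_sum big_seq big1 // => k /l_on kl.
by rewrite raddfMz raddfB /= !pairingU hf // subrr mul0rz.
Qed.

(** Summation by parts on one edge: on the divisor of a hinge, an affine function of slope [a] takes
    [a] times the value of the hinge at the target. *)
Lemma edge_real_pairing (f : gpoint G -> R) e D d a :
  (forall t, 0 <= t <= len e -> f (vpt (tgt e)) - f (ept e t) = a * (len e - t)) ->
  edge_real e D d -> pairing f D = a * d.
Proof.
move=> hf [l /allP l_on [-> ->]]; rewrite /edge_chips raddf_sum mulr_sumr !big_seq.
apply: eq_bigr => k /l_on kl; rewrite raddfMz raddfB /= !pairingU hf //.
by rewrite -mulrzr; ring.
Qed.

Lemma pairing_coeff (A : pzRingType) D q (c : A) :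
  pairing (fun p => c * (p == q)%:R) D = c * (coeff q D)%:~R.
Proof.
move: D; apply: freeg_zmod_ind => [|D1 D2 e1 e2|p]; first by rewrite !raddf0 mulr0.
  by rewrite !raddfB /= e1 e2 mulrBr.
by rewrite pairingU coeff_point; case: eqP.
Qed.

Lemma pairingD_fun (M : zmodType) (f1 f2 : gpoint G -> M) D :
  pairing (fun p => f1 p + f2 p) D = pairing f1 D + pairing f2 D.
Proof.
move: D; apply: freeg_zmod_ind => [|D1 D2 e1 e2|p]; first by rewrite !raddf0 addr0.
  by rewrite !raddfB /= e1 e2 opprD addrACA.
by rewrite !pairingU.
Qed.

Section Harmonic.
Context (V : vertex G -> R) (E : edge G -> divisor G).
Hypothesis E_real : forall e, edge_real e (E e) (V (tgt e) - V (src e)).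
Hypothesis E_sum0 : \sum_e E e = 0.

(* Pairing the divisor with the function interpolating V affinely on the edges
   gives the energy of V. *)
Lemma harmonic_cst e : V (tgt e) = V (src e).
Proof.
pose f (p : gpoint G) := match p with
  | inl v => V v
  | inr x => let e := (val x).1 in
      V (src e) + (V (tgt e) - V (src e)) / len e * (val x).2 end.
have hf e' t : 0 <= t <= len e' -> f (vpt (tgt e')) - f (ept e' t) =
    (V (tgt e') - V (src e')) / len e' * (len e' - t).
  have l0 : len e' != 0 by rewrite gt_eqF ?len_gt0.
  move: t; apply: (edge_param_ind (P := fun t p => f (vpt (tgt e')) - f p =
    (V (tgt e') - V (src e')) / len e' * (len e' - t))) => /=.
  - by rewrite subr0 divfK.
  - by rewrite !subrr mulr0.
  - by move=> t _; field.
have /esym := congr1 (pairing f) E_sum0; rewrite raddf0 raddf_sum /=.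
rewrite (eq_bigr (fun e => (V (tgt e) - V (src e)) ^+ 2 / len e)); last first.
  by move=> e' _; rewrite (edge_real_pairing (hf e') (E_real e')); ring.
move/esym/psumr_eq0P => /(_ _ e isT) h.
have {}h : (V (tgt e) - V (src e)) ^+ 2 / len e = 0.
  by apply: h => e' _; rewrite divr_ge0 ?sqr_ge0 ?ltW ?len_gt0.
apply/eqP; rewrite -subr_eq0 -sqrf_eq0; move/eqP: h.
by rewrite mulf_eq0 invr_eq0 (gt_eqF (len_gt0 e)) orbF.
Qed.

(** The test function [f] is affine inside [e] and 0 elsewhere, vertices included, so its pairing
    with the total divisor only sees [E e]. Adding [f0] restores the value at the source and makes
    it affine on the closed edge; the pairing is still 0, since the increment along [e] vanishes by
    [harmonic_cst]. *)
Lemma harmonic_src e : src e != tgt e -> coeff (vpt (src e)) (E e) = 0.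
Proof.
move=> st; pose f (p : gpoint G) := match p with
  | inl v => 0
  | inr x => if (val x).1 == e then len e - (val x).2 else 0 end.
pose f0 p := len e * (p == vpt (src e) :> gpoint G)%:R.
have fE : pairing f (E e) = 0.
  have := congr1 (pairing f) E_sum0; rewrite raddf0 raddf_sum /= (bigD1 e) //=.
  rewrite [X in _ + X]big1 ?addr0 // => e' e'e.
  rewrite (@edge_real_pairing f e' _ _ 0 _ (E_real e')) ?mul0r //.
  apply: (edge_param_ind (P := fun t p => f (vpt (tgt e')) - f p = 0 * (len e' - t))) => /=;
    rewrite ?mul0r ?subrr // => t _.
  by rewrite (negbTE e'e) mul0r subrr.
have ts : (vpt (tgt e) == vpt (src e)) = false by rewrite eq_sym; apply/negbTE.
have : pairing (fun p => f p + f0 p) (E e) = 0.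
  rewrite (@edge_real_pairing _ e _ _ (- 1) _ (E_real e)) ?harmonic_cst ?subrr ?mulr0 //.
  apply: (edge_param_ind (P := fun t p => f (vpt (tgt e)) + f0 (vpt (tgt e)) - (f p + f0 p)
     = - 1 * (len e - t))) => /=; rewrite /f0 ?ts ?eqxx /=; [ring|ring|move=> t h].
  by ring.
rewrite pairingD_fun fE add0r pairing_coeff => /eqP.
by rewrite mulf_eq0 (gt_eqF (len_gt0 e)) intr_eq0 => /eqP.
Qed.

End Harmonic.

End EdgeReal.

Section EdgeMap.
Context (R : realType) (G H : metric_graph R).
Context (fv : vertex G -> vertex H) (fe : edge G -> edge H).
Hypothesis src_fe : forall e, src (fe e) = fv (src e).
Hypothesis tgt_fe : forall e, tgt (fe e) = fv (tgt e).
Hypothesis len_fe : forall e, len (fe e) = len e.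

Lemma Nm_edge_chips e l : on_edge e l ->
  Nm (map_point fv fe) (edge_chips e l) = edge_chips (fe e) l.
Proof.
move=> /allP l_on; rewrite /edge_chips raddf_sum !big_seq; apply: eq_bigr => k /l_on kl.
by rewrite raddfMz raddfB /= !NmU map_point_ept //= tgt_fe.
Qed.

Lemma edge_real_map e D d :
  edge_real e D d -> edge_real (fe e) (Nm (map_point fv fe) D) d.
Proof.
move=> [l l_on [-> ->]]; exists l; first by rewrite /on_edge len_fe.
by rewrite Nm_edge_chips // len_fe.
Qed.

End EdgeMap.

(** * Functions on a loop and the condition along the long cycle *)

Section LoopReal.
Context (R : realType) (n : nat) (G : loop_of_loops R n).
Implicit Types (j : 'I_n) (D : divisor G) (x : R).

Lemma big_ll_edge (M : nmodType) (F : ll_edge n -> M) :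
  \sum_e F e = \sum_j (F (Ewv j) + F (Evw j) + F (Ebeta j)).
Proof.
rewrite (reindex (@ll_edge_of n)); last first.
  by exists (@ll_edge_to n) => [[[]|]|[]].
rewrite big_sumType big_sumType /= !big_split /=; congr (_ + _).
by rewrite addrC.
Qed.

(** The position is an arc length from w_j, which removes the scaling by [len_vw] from linear
    conditions on positions. *)
Definition circle_pt j x : gpoint G :=
  let r := x - (Num.floor (x / loop_len G j))%:~R * loop_len G j in
  if r < len_wv G j then @ept R G (Ewv j) r
  else @ept R G (Evw j) (r - len_wv G j).

Lemma loop_pointE j xi : loop_point G j xi = circle_pt j (xi * len_vw G j).
Proof. by []. Qed.

(* A function on the loop with divisor \sum_k c_k <x_k> exists iff
   \sum_k c_k = \sum_k c_k x_k = 0 for suitable real lifts x_k of the positions;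
   its increment from w_j to v_j is then \sum_k c_k * loop_drop x_k. *)
Definition loop_drop (a b x : R) : R :=
  let z := (Num.floor (x / (a + b)))%:~R in
  z * b - Num.max 0 (b - (x - z * (a + b))).

Lemma floor_periodic (l r : R) (z : int) : 0 <= r < l ->
  Num.floor ((z%:~R * l + r) / l) = z.
Proof.
move=> /andP[r0 rl]; have l0 : 0 < l by apply: le_lt_trans rl.
apply/eqP; rewrite floor_eq; apply/andP; split.
  by rewrite ler_pdivlMr //; lra.
by rewrite ltr_pdivrMr // intrD; lra.
Qed.

Lemma periodic_decomp (l x : R) : 0 < l ->
  exists (z : int) r, 0 <= r < l /\ x = z%:~R * l + r.
Proof.
move=> l0; exists (Num.floor (x / l)), (x - (Num.floor (x / l))%:~R * l).
have := floor_itv (x / l); rewrite ler_pdivlMr // ltr_pdivrMr // intrD => /andP[h1 h2].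
by split; [apply/andP; split; lra|ring].
Qed.

Lemma loop_dropE (a b r : R) (z : int) : 0 <= r < a + b ->
  loop_drop a b (z%:~R * (a + b) + r) = z%:~R * b - Num.max 0 (b - r).
Proof. by move=> h; rewrite /loop_drop floor_periodic // addrAC subrr add0r. Qed.

(** The reflection exchanges v_j and w_j and reverses each of the two edges of the loop, so the two
    cases follow the edge containing the point. *)
Lemma loop_drop_refl (a b x : R) : 0 < a -> 0 < b ->
  loop_drop a b (- a - x) = - 2 * b - loop_drop a b x.
Proof.
move=> a0 b0; have [|z [r [/andP[r0 rl] ->]]] := @periodic_decomp (a + b) x.
  by apply: addr_gt0.
rewrite loop_dropE ?r0 //; have [br|rb] := leP r b.
  rewrite (_ : - a - _ = (- z - 1)%:~R * (a + b) + (b - r)); last by rewrite intrB intrN; ring.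
  rewrite loop_dropE; last by apply/andP; split; lra.
  by rewrite !max_r ?intrB ?intrN; [ring|lra|lra].
rewrite (_ : - a - _ = (- z - 2)%:~R * (a + b) + (b + (a + b) - r)); last first.
  by rewrite intrB intrN; ring.
rewrite loop_dropE; last by apply/andP; split; lra.
by rewrite !max_l ?intrB ?intrN; [ring|lra|lra].
Qed.

Lemma loop_len_gt0 j : 0 < loop_len G j.
Proof. by rewrite addr_gt0 ?len_vw_gt0 ?len_wv_gt0. Qed.

Lemma circle_ptE j (z : int) r : 0 <= r < loop_len G j ->
  circle_pt j (z%:~R * loop_len G j + r) =
  if r < len_wv G j then @ept R G (Ewv j) r
  else @ept R G (Evw j) (r - len_wv G j).
Proof. by move=> h; rewrite /circle_pt floor_periodic // addrAC subrr add0r. Qed.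

Lemma circle_pt_periodic j (k : int) x :
  circle_pt j (x + k%:~R * loop_len G j) = circle_pt j x.
Proof.
have [z [r [hr ->]]] := periodic_decomp x (loop_len_gt0 j).
have -> : z%:~R * loop_len G j + r + k%:~R * loop_len G j =
  (z + k)%:~R * loop_len G j + r by rewrite intrD; ring.
by rewrite !circle_ptE.
Qed.

Lemma circle_pt0 j : circle_pt j 0 = @vpt R G (Vw j).
Proof.
have := @circle_ptE j 0 0; rewrite lexx loop_len_gt0 mul0r addr0 => -> //.
by rewrite len_wv_gt0 ept0.
Qed.

Lemma circle_pt_v j : circle_pt j (- len_vw G j) = @vpt R G (Vv j).
Proof.
have := @circle_ptE j (-1) (len_wv G j); rewrite ltW ?len_wv_gt0 // ltrDr len_vw_gt0.
rewrite ltxx subrr ept0 => <- //; congr circle_pt.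
by rewrite intrN /loop_len; ring.
Qed.

(** [d1] and [d2] are the increments from w_j to v_j and back. They need not cancel, which allows
    points to be treated one at a time; a genuine function on the loop has [d2 = - d1]. *)
Definition loop_real j D (d1 d2 : R) := exists D1 D2,
  [/\ D = D1 + D2, @edge_real R G (Ewv j) D1 d1 & @edge_real R G (Evw j) D2 d2].

Lemma loop_realB j D D' d1 d2 d1' d2' :
  loop_real j D d1 d2 -> loop_real j D' d1' d2' ->
  loop_real j (D - D') (d1 - d1') (d2 - d2').
Proof.
move=> [D1 [D2 [-> h1 h2]]] [D1' [D2' [-> h1' h2']]].
by exists (D1 - D1'), (D2 - D2'); split; [freeg_ring|apply: edge_realB|apply: edge_realB].
Qed.

Lemma loop_realD j D D' d1 d2 d1' d2' :
  loop_real j D d1 d2 -> loop_real j D' d1' d2' ->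
  loop_real j (D + D') (d1 + d1') (d2 + d2').
Proof.
move=> [D1 [D2 [-> h1 h2]]] [D1' [D2' [-> h1' h2']]].
by exists (D1 + D1'), (D2 + D2'); split; [freeg_ring|apply: edge_realD|apply: edge_realD].
Qed.

(** Let [z] be the number of full turns in [x]. The multivalued function used has slope [z] from w_j
    to the point and [z - 1] from there on, and gains [x - loop_len] per turn. In a combination of
    degree 0 the terms [loop_len] cancel, and it closes up once the positions cancel as well. *)
Lemma loop_real_pt j x : let d := loop_drop (len_vw G j) (len_wv G j) x in
  loop_real j (<< circle_pt j x >> - << @vpt R G (Vw j) >>) d (x - loop_len G j - d).
Proof.
have [z [r [hr ->]]] := periodic_decomp x (loop_len_gt0 j).
have /andP[r0 rl] := hr; have a0 := len_vw_gt0 G j; have b0 := len_wv_gt0 G j.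
rewrite /= loop_dropE // circle_ptE //; rewrite /loop_len in rl *.
have aon : 0 <= (0 : R) <= len_vw G j by rewrite lexx ltW.
have bon : 0 <= (0 : R) <= len_wv G j by rewrite lexx ltW.
case: ltP => rb.
  exists (@edge_chips R G (Ewv j) [:: (z, 0); (- 1, r)]),
         (@edge_chips R G (Evw j) [:: (z - 1, 0)]).
  split.
  - rewrite /edge_chips !big_cons !big_nil /= !ept0 /=.
    by freeg_ring.
  - exists [:: (z, 0); (- 1, r)]; first by rewrite /on_edge /= bon r0 ltW.
    split => //; rewrite !big_cons big_nil /= max_r ?subr_ge0 1?ltW //.
    by rewrite intrN; ring.
  - exists [:: (z - 1, 0)]; first by rewrite /on_edge /= aon.
    split => //; rewrite !big_cons big_nil /= max_r ?subr_ge0 1?ltW //.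
    by rewrite intrB; ring.
exists (@edge_chips R G (Ewv j) [:: (z, 0)]),
       (@edge_chips R G (Evw j) [:: (z, 0); (- 1, r - len_wv G j)]).
split.
- rewrite /edge_chips !big_cons !big_nil /= !ept0 /=.
  by freeg_ring.
- exists [:: (z, 0)]; first by rewrite /on_edge /= bon.
  split => //; rewrite !big_cons big_nil /= max_l ?subr_le0 //.
  by ring.
- exists [:: (z, 0); (- 1, r - len_wv G j)].
    by rewrite /on_edge /= aon subr_ge0 rb lerBlDr ltW.
  split => //; rewrite !big_cons big_nil /= max_l ?subr_le0 //.
  by rewrite intrN; ring.
Qed.

Lemma beta_real_pt j t : 0 <= t <= len_beta G j ->
  @edge_real R G (Ebeta j) (<< ept (Ebeta j : edge G) t >> - << @vpt R G (Vv j) >>)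
    (t - len_beta G j).
Proof.
move=> ht; exists [:: (- 1, t)]; first by rewrite /on_edge /= andbT.
rewrite /edge_chips !big_cons !big_nil /=; split; first by freeg_ring.
by rewrite intrN; ring.
Qed.

(** Once each loop closes up, the only remaining obstruction is the total increment around the cycle
    through all loops and bridges. *)
Lemma principal_loops (Dl Db : 'I_n -> divisor G) (d s : 'I_n -> R) :
  (forall j, loop_real j (Dl j) (d j) (- d j)) ->
  (forall j, @edge_real R G (Ebeta j) (Db j) (s j)) ->
  \sum_j (s j - d j) = 0 -> \sum_j (Dl j + Db j) \in @principal R G.
Proof.
move=> /choice[D1 /choice[D2 hl]] hb sum0.
(* [W k] is the value at w_(k-1): passing from w_(j-1) to w_j adds [s j] on the bridge and [- d j]
   from v_j to w_j. *)
pose W k := \sum_(i < n | (i < k)%N) (s i - d i).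
have WS j : W j.+1 = W j + (s j - d j).
  rewrite /W (bigD1 j) //= addrC; congr (_ + _); apply: eq_bigl => i.
  by rewrite ltnS [(i < j)%N]ltn_neqAle andbC.
have W0 : W 0%N = 0 by rewrite /W big_pred0.
have Wn : W n = 0 by rewrite /W -[RHS]sum0; apply: eq_bigl => i; rewrite ltn_ord.
(* At index 0 the predecessor is the last index, and this is where [W n = W 0] closes the cycle. *)
have Wpred j : W (ord_pred j).+1 = W j.
  case: j => [[|k] kn]; rewrite /=.
    by rewrite W0 add0n modn_small ?prednK // Wn.
  by rewrite modnDr modn_small // ltnW.
pose V (v : ll_vertex n) := match v with Vw j => W j.+1 | Vv j => W j.+1 + d j end.
pose E (e : ll_edge n) := match e with
  | Ewv j => D1 j | Evw j => D2 j | Ebeta j => Db j end.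
apply/principalP; exists V, E; split.
  case=> j /=; have [_ h1 h2] := hl j.
  - by rewrite opprD addrA subrr sub0r.
  - by rewrite addrAC subrr add0r.
  - by rewrite Wpred WS (_ : _ - _ = s j) //; ring.
rewrite big_ll_edge; apply: eq_bigr => j _; have [-> _ _] := hl j.
by [].
Qed.

End LoopReal.

Lemma divclassP (R : realType) (G : metric_graph R) (D1 D2 : divisor G) :
  divclass D1 = divclass D2 <-> D1 - D2 \in @principal R G.
Proof.
rewrite /divclass (Quotient.idealrBE (@principal R G) D1 D2).
by split => [->|/eqP].
Qed.

(** * Indices modulo 2n as two sheets of indices modulo n *)

Section DoubleIndices.
Context (n : nat).
Implicit Types (j : 'I_n) (k : 'I_(2 * n)).

Lemma sheet0_subproof j : (j < 2 * n)%N.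
Proof. by have := ltn_ord j; lia. Qed.
Lemma sheet1_subproof j : (n + j < 2 * n)%N.
Proof. by have := ltn_ord j; lia. Qed.

Definition sheet0 j : 'I_(2 * n) := Ordinal (sheet0_subproof j).
Definition sheet1 j : 'I_(2 * n) := Ordinal (sheet1_subproof j).

Lemma ll_red_sheet0 j : ll_red (sheet0 j) = j.
Proof. by apply/val_inj; rewrite /= modn_small. Qed.

Lemma ll_red_sheet1 j : ll_red (sheet1 j) = j.
Proof. by apply/val_inj; rewrite /= modnDl modn_small. Qed.

Lemma double_index k :
  (k < n)%N /\ k = sheet0 (ll_red k) \/ (n <= k)%N /\ k = sheet1 (ll_red k).
Proof.
have [kn|nk] := ltnP k n; [left|right]; split=> //; apply/val_inj => /=.
  by rewrite modn_small.
have -> : (k = n + (k - n) :> nat)%N by rewrite subnKC.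
by rewrite modnDl modn_small //; have := ltn_ord k; lia.
Qed.

Lemma double_index_ind (P : 'I_(2 * n) -> Prop) :
  (forall j, P (sheet0 j)) -> (forall j, P (sheet1 j)) -> forall k, P k.
Proof. by move=> h0 h1 k; case: (double_index k) => [[_ ->]|[_ ->]]. Qed.

Lemma val_iter_ordS m k : iter m (@ordS _) k = ((k + m) %% (2 * n))%N :> nat.
Proof.
elim: m => [|m IH] /=; first by rewrite addn0 modn_small.
by rewrite IH addnS -[X in (X %% _)%N = _]addn1 -[X in _ = (X %% _)%N]addn1 modnDml.
Qed.

Lemma ll_shift_sheet0 j : ll_shift (sheet0 j) = sheet1 j.
Proof.
apply/val_inj; rewrite /ll_shift /= val_iter_ordS /= addnC modn_small //.
exact: sheet1_subproof.
Qed.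

Lemma ll_shift_sheet1 j : ll_shift (sheet1 j) = sheet0 j.
Proof.
apply/val_inj; rewrite /ll_shift /= val_iter_ordS /=.
rewrite (_ : (n + j + n = j + 2 * n)%N); last by lia.
by rewrite modnDr modn_small // sheet0_subproof.
Qed.

Lemma ll_shiftK : involutive (@ll_shift n).
Proof.
by apply: double_index_ind => j; rewrite ?(ll_shift_sheet0, ll_shift_sheet1).
Qed.

Lemma ll_red_shift k : ll_red (ll_shift k) = ll_red k.
Proof.
by move: k; apply: double_index_ind => j;
  rewrite ?(ll_shift_sheet0, ll_shift_sheet1) ll_red_sheet0 ll_red_sheet1.
Qed.

Lemma ll_shift_pred k : ll_shift (ord_pred k) = ord_pred (ll_shift k).
Proof.
rewrite /ll_shift.
suff H m : iter m (@ordS _) (ord_pred k) = ord_pred (iter m (@ordS _) k) by exact: H.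
by elim: m => //= m ->; rewrite ord_predK ordSK.
Qed.

Lemma ll_red_pred k : ll_red (ord_pred k) = ord_pred (ll_red k).
Proof.
have redS i : ll_red (ordS i) = ordS (ll_red i) :> 'I_n.
  apply/val_inj; rewrite /= modn_dvdm ?dvdn_mull //.
  by rewrite -[X in (X %% _)%N = _]addn1 -[X in _ = (X %% _)%N]addn1 modnDml.
by rewrite -[k in RHS]ord_predK redS ordSK.
Qed.

Lemma big_double (M : nmodType) (F : 'I_(2 * n) -> M) :
  \sum_k F k = \sum_j (F (sheet0 j) + F (sheet1 j)).
Proof.
pose f (s : 'I_n + 'I_n) := match s with inl j => sheet0 j | inr j => sheet1 j end.
rewrite (reindex f) ?big_sumType ?big_split //=.
exists (fun k : 'I_(2 * n) => if (k < n)%N then inl (ll_red k) else inr (ll_red k)).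
  by case=> j _ /=; rewrite ?ltn_ord ?ll_red_sheet0 // ltnNge leq_addr ll_red_sheet1.
move=> k _; case: (double_index k) => [[-> ->]|[nk E]] /=; first by rewrite ll_red_sheet0.
by rewrite ltnNge nk /= -E.
Qed.

End DoubleIndices.

(** * The antipode, the covering map and the kernel of the norm *)

Section Cover.
Context (R : realType) (n : nat) (G : loop_of_loops R n).
Local Notation G2 := (double_cover G).
Implicit Types (j : 'I_n) (k : 'I_(2 * n)) (p : gpoint G2).

Let edge_shift (e : edge G2) : edge G2 := ll_edge_map (@ll_shift n) e.
Let vertex_shift (v : vertex G2) : vertex G2 := ll_vertex_map (@ll_shift n) v.
Let edge_red (e : edge G2) : edge G := ll_edge_map (@ll_red n) e.
Let vertex_red (v : vertex G2) : vertex G := ll_vertex_map (@ll_red n) v.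

Lemma src_shift e : src (edge_shift e) = vertex_shift (src e).
Proof. by case: e => k //=; rewrite /edge_shift /= /vertex_shift /= ll_shift_pred. Qed.
Lemma tgt_shift e : tgt (edge_shift e) = vertex_shift (tgt e).
Proof. by case: e. Qed.
Lemma len_shift e : len (edge_shift e) = len e.
Proof. by case: e => k /=; rewrite ll_red_shift. Qed.
Lemma src_red e : src (edge_red e) = vertex_red (src e).
Proof. by case: e => k //=; rewrite /edge_red /= /vertex_red /= ll_red_pred. Qed.
Lemma tgt_red e : tgt (edge_red e) = vertex_red (tgt e).
Proof. by case: e. Qed.
Lemma len_red e : len (edge_red e) = len e.
Proof. by case: e. Qed.

Lemma edge_shiftK : involutive edge_shift.
Proof. by case=> k; rewrite /edge_shift /= ll_shiftK. Qed.
Lemma vertex_shiftK : involutive vertex_shift.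
Proof. by case=> k; rewrite /vertex_shift /= ll_shiftK. Qed.

Lemma antipode_ept (e : edge G2) t : 0 <= t <= len e ->
  antipode (ept e t) = ept (edge_shift e) t.
Proof. exact: (map_point_ept src_shift tgt_shift len_shift). Qed.

Lemma cover_ept (e : edge G2) t : 0 <= t <= len e ->
  cover_map (ept e t) = ept (edge_red e) t.
Proof. exact: (map_point_ept src_red tgt_red len_red). Qed.

Lemma antipodeK : involutive (@antipode R n G).
Proof.
apply: gpoint_ind => [v|e t ht _]; first by rewrite /= -[RHS](f_equal _ (vertex_shiftK v)).
by rewrite !antipode_ept ?len_shift // edge_shiftK.
Qed.

Lemma cover_antipode p : cover_map (antipode p) = cover_map p.
Proof.
move: p; apply: gpoint_ind => [[] k|e t ht _]; try by rewrite /= ll_red_shift.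
rewrite antipode_ept // !cover_ept ?len_shift //.
by case: e {ht} => k; rewrite /edge_red /edge_shift /= ll_red_shift.
Qed.

Lemma loop_rem_le (H : loop_of_loops R (2 * n)) k r :
  0 <= r < loop_len H k -> ~~ (r < len_wv H k) ->
  0 <= r - len_wv H k <= len_vw H k.
Proof. by rewrite -leNgt /loop_len => /andP[h1 h2] h3; apply/andP; split; lra. Qed.

Lemma antipode_circle k x : antipode (circle_pt G2 k x) = circle_pt G2 (ll_shift k) x.
Proof.
have EL : loop_len G2 (ll_shift k) = loop_len G2 k by rewrite /loop_len /= ll_red_shift.
have [z [r [hr ->]]] := periodic_decomp x (loop_len_gt0 G2 k).
rewrite circle_ptE // -EL circle_ptE ?EL //.
rewrite [len_wv G2 (ll_shift k)]/= ll_red_shift.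
have /andP[r0 _] := hr; case: ifPn => rb.
  by rewrite antipode_ept //= r0 ltW.
by rewrite antipode_ept //=; apply: (loop_rem_le hr).
Qed.

Lemma cover_circle k x : cover_map (circle_pt G2 k x) = circle_pt G (ll_red k) x.
Proof.
have EL : loop_len G2 k = loop_len G (ll_red k) by [].
have [z [r [hr ->]]] := periodic_decomp x (loop_len_gt0 G2 k).
rewrite circle_ptE // EL circle_ptE //.
have /andP[r0 _] := hr; case: ifPn => rb; first by rewrite cover_ept //= r0 ltW.
by rewrite cover_ept //=; apply: (loop_rem_le hr).
Qed.

(** A section of sets only: it tears at the start of the bridge 0, whose lift to the first sheet
    starts on the other sheet. *)
Definition section_map : gpoint G -> gpoint G2 :=
  @map_point R G G2 (ll_vertex_map (@sheet0 n)) (ll_edge_map (@sheet0 n)).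

Lemma cover_fibre p :
  p = section_map (cover_map p) \/ p = antipode (section_map (cover_map p)).
Proof.
move: p; apply: gpoint_ind => [v|e t ht ht'].
  by case: v => k; case: (double_index k) => [[_ E]|[_ E]] /=; [left|right|left|right];
    rewrite -?E // ll_shift_sheet0 -E.
have h : 0 < (edge_red e, t).2 < len (edge_red e, t).1 by rewrite len_red.
have sE : section_map (cover_map (ept e t)) = ept (ll_edge_map (@sheet0 n) (edge_red e) : edge G2) t.
  by rewrite cover_ept // (ept_inr h).
rewrite sE antipode_ept; last by case: (e) ht => k /=; rewrite ll_red_sheet0.
by case: e {h sE ht ht'} => k; case: (double_index k) => [[_ E]|[_ E]];
  [left|right|left|right|left|right]; rewrite /edge_shift /edge_red /=;
  rewrite ?ll_shift_sheet0 -E.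
Qed.

Definition anti_pt p : divisor G2 := << p >> - << antipode p >>.

Lemma anti_pt_antipode p : anti_pt (antipode p) = - anti_pt p.
Proof. by rewrite /anti_pt antipodeK opprB. Qed.

(** Each point is the section of its image or the antipode of that, so a divisor differs from the
    section of its norm by some F - F^-. *)
Lemma Nm_cover_kernel (D : divisor G2) : Nm (@cover_map R n G) D = 0 ->
  exists F, D = F - Nm (@antipode R n G) F.
Proof.
move=> D0; have [F] : exists F, D =
    Nm section_map (Nm (@cover_map R n G) D) + (F - Nm (@antipode R n G) F).
  move: (D); apply: freeg_zmod_ind => [|D1 D2 [F1 e1] [F2 e2]|p].
  - by exists 0; rewrite !raddf0 !addr0.
  - exists (F1 - F2); rewrite {1}e1 {1}e2 !raddfB /=.
    by freeg_ring.
  - rewrite !NmU; case: (cover_fibre p) => E.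
      by exists 0; rewrite -E raddf0 subrr addr0.
    by exists (- << section_map (cover_map p) >>); rewrite raddfN /= NmU -E; freeg_ring.
by rewrite D0 raddf0 add0r => ->; exists F.
Qed.

End Cover.

(** * The canonical divisor of a loop of loops *)

Section Canonical.
Context (R : realType) (n : nat) (G : loop_of_loops R n).

Lemma big_ll_vertex (M : nmodType) (F : ll_vertex n -> M) :
  \sum_v F v = \sum_j (F (Vv j) + F (Vw j)).
Proof.
rewrite (reindex (@ll_vertex_of n)); last by exists (@ll_vertex_to n) => [[]|[]].
by rewrite big_sumType big_split.
Qed.

Lemma valence_ll (v : vertex G) : valence v = 3.
Proof.
rewrite /valence; case: v => i.
  rewrite (@eq_card _ _ (pred1 (Evw i : edge G))) ?card1; last first.
    by case=> j; rewrite !inE.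
  rewrite (@eq_card _ _ (pred2 (Ewv i : edge G) (Ebeta i : edge G))) ?card2 //.
  by case=> j; rewrite !inE ?orbF.
rewrite (@eq_card _ _ (pred2 (Ewv i : edge G) (Ebeta (ordS i) : edge G))) ?card2; last first.
  case=> j; rewrite !inE ?orbF //=.
  transitivity (ord_pred j == i) => //; transitivity (j == ordS i) => //.
  by apply/eqP/eqP => [<-|->]; rewrite ?ord_predK ?ordSK.
rewrite (@eq_card _ _ (pred1 (Evw i : edge G))) ?card1 //.
by case=> j; rewrite !inE.
Qed.

Lemma canonical_ll :
  canonical_divisor G = \sum_j (<< @vpt R G (Vv j) >> + << @vpt R G (Vw j) >>).
Proof.
rewrite /canonical_divisor -(big_ll_vertex (fun v => << @vpt R G v >>)).
by apply: eq_bigr => v _; rewrite valence_ll.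
Qed.

End Canonical.

Section DoubleSums.
Context (n : nat).

Definition double_pick (T : Type) (a b : 'I_n -> T) (k : 'I_(2 * n)) : T :=
  if (k < n)%N then a (ll_red k) else b (ll_red k).

Lemma double_pick0 (T : Type) (a b : 'I_n -> T) j : double_pick a b (sheet0 j) = a j.
Proof. by rewrite /double_pick /= ltn_ord ll_red_sheet0. Qed.

Lemma double_pick1 (T : Type) (a b : 'I_n -> T) j : double_pick a b (sheet1 j) = b j.
Proof. by rewrite /double_pick /= ltnNge leq_addr ll_red_sheet1. Qed.

Lemma big_double_edge (M : nmodType) (F : ll_edge (2 * n) -> M) :
  \sum_e F e = \sum_e (F (ll_edge_map (@sheet0 n) e) + F (ll_edge_map (@sheet1 n) e)).
Proof.
rewrite !big_ll_edge big_double; apply: eq_bigr => j _ /=.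
by rewrite (addrACA (F _ + F _)) (addrACA (F _)).
Qed.

(** The bridge [k] starts at index [k - 1] modulo 2n, so the sheets meet exactly along the bridges 0
    and [n]. *)
Lemma ord_pred_double_lt (k : 'I_(2 * n)) : (ord_pred k < n)%N = (0 < k <= n)%N.
Proof.
case: k => [[|k] kn] /=; first by rewrite add0n modn_small; lia.
by rewrite modnDr modn_small // ltnW.
Qed.

Definition ll_edge_idx m (e : ll_edge m) : 'I_m :=
  match e with Evw j | Ewv j | Ebeta j => j end.
Definition ll_vertex_idx m (v : ll_vertex m) : 'I_m :=
  match v with Vv j | Vw j => j end.

End DoubleSums.

(** * Lifting principal divisors, and moves on antipodal pairs *)

Section Prym.
Context (R : realType) (n : nat) (n_gt0 : (0 < n)%N) (G : loop_of_loops R n).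
Local Notation G2 := (double_cover G).
Local Notation circ := (circle_pt G2).
Implicit Types (x a b : 'I_n -> R).

(* A function phi on G, normalized to vanish at the vertex w_(n-1), is lifted to
   phi on the sheet of indices k < n and to 0 on the other sheet. *)
Lemma principal_lift (D : divisor G) : D \in @principal R G ->
  exists2 Psi, Psi \in @principal R G2 & Nm (@cover_map R n G) Psi = D.
Proof.
move=> /principalP[V [E [hE ->]]].
have /choice[l hl] : forall e, exists l, on_edge e l /\ (E e = edge_chips e l /\
    V (tgt e) - V (src e) = \sum_(k <- l) k.1%:~R * (len e - k.2)).
  by move=> e; have [l l1 l2] := hE e; exists l.
pose red (e : edge G2) : edge G := ll_edge_map (@ll_red n) e.
pose c := V (Vw (ord_pred (Ordinal n_gt0))).
pose V2 (v : vertex G2) :=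
  if (ll_vertex_idx v < n)%N then V (ll_vertex_map (@ll_red n) v) - c else 0.
pose E2 (e : edge G2) : divisor G2 :=
  if (ll_edge_idx e < n)%N then edge_chips e (l (red e)) else 0.
have V2tgt (e : edge G2) :
    V2 (tgt e) = if (ll_edge_idx e < n)%N then V (tgt (red e)) - c else 0.
  by case: e.
have V2src (e : edge G2) :
    V2 (src e) = if (ll_edge_idx e < n)%N then V (src (red e)) - c else 0.
  case: e => k //=; rewrite /V2 /= ord_pred_double_lt ll_red_pred.
  (* The bridges 0 and [n] of the cover both lie over the bridge 0 of [G], at whose source the value
     is [c]; the normalized lift is thus 0 at both starts, whichever sheet they belong to. *)
  have red0 : (k = 0 :> nat)%N \/ (k = n :> nat)%N -> ll_red k = Ordinal n_gt0.
    by case=> E0; apply/val_inj; rewrite /= E0 ?mod0n ?modnn.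
  case: (posnP k) => [k0|k0] /=; first by rewrite k0 n_gt0 (red0 (or_introl k0)) subrr.
  rewrite leq_eqVlt; case: eqP => [kn|_] //=.
  by rewrite kn ltnn (red0 (or_intror kn)) subrr.
exists (\sum_e E2 e).
  apply/principalP; exists V2, E2; split=> // e; rewrite V2tgt V2src /E2.
  case: ifP => _; last by rewrite subrr; apply: edge_real0.
  have [l1 [_ l2]] := hl (red e); exists (l (red e)).
    by move: l1; rewrite /on_edge len_red.
  by split=> //; rewrite -(len_red e) -l2; ring.
rewrite raddf_sum big_double_edge; apply: eq_bigr => e _ /=.
have e1 : (ll_edge_idx (ll_edge_map (@sheet1 n) e) < n)%N = false.
  by case: e => j /=; rewrite ltnNge leq_addr.
have e0 : (ll_edge_idx (ll_edge_map (@sheet0 n) e) < n)%N.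
  by case: (e) => j /=.
have rede : red (ll_edge_map (@sheet0 n) e) = e.
  by case: (e) => j; rewrite /red /= ll_red_sheet0.
rewrite /E2 e0 e1 raddf0 addr0 rede; have [l1 [-> _]] := hl e.
rewrite (Nm_edge_chips (@src_red R n G) (@tgt_red R n G) (@len_red R n G)).
  by congr edge_chips.
by move: l1; rewrite /on_edge -len_red -/(red _) rede.
Qed.

(** Opposite increments on the two sheets cancel in the condition along the long cycle. *)
Lemma principal_double (X Y Xb Yb : 'I_n -> divisor G2) (d s : 'I_n -> R) :
  (forall j, loop_real (sheet0 j) (X j) (d j) (- d j)) ->
  (forall j, loop_real (sheet1 j) (Y j) (- d j) (d j)) ->
  (forall j, @edge_real R G2 (Ebeta (sheet0 j)) (Xb j) (s j)) ->
  (forall j, @edge_real R G2 (Ebeta (sheet1 j)) (Yb j) (- s j)) ->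
  \sum_j (X j + Y j + (Xb j + Yb j)) \in @principal R G2.
Proof.
move=> hX hY hXb hYb.
have := @principal_loops R (2 * n) G2 (double_pick X Y) (double_pick Xb Yb)
  (double_pick d (fun j => - d j)) (double_pick s (fun j => - s j)).
rewrite !big_double => H.
rewrite (eq_bigr (fun j => double_pick X Y (sheet0 j) + double_pick Xb Yb (sheet0 j) +
  (double_pick X Y (sheet1 j) + double_pick Xb Yb (sheet1 j)))); last first.
  by move=> j _; rewrite !double_pick0 !double_pick1 addrACA.
apply: H.
- by apply: double_index_ind => j; rewrite ?double_pick0 ?double_pick1 ?opprK.
- by apply: double_index_ind => j; rewrite ?double_pick0 ?double_pick1.
- by rewrite big1 // => j _; rewrite !double_pick0 !double_pick1; ring.
Qed.

(** The divisors defining P^0, in arc length: the coordinates on the first sheet are free and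
    determine those on the second. *)
Definition antisym_divisor x : divisor G2 :=
  \sum_j (<< circ (sheet0 j) (x j) >> + << circ (sheet1 j) (- len_vw G j - x j) >>).

Lemma antipode_sheet0 j (t : R) : antipode (circ (sheet0 j) t) = circ (sheet1 j) t.
Proof. by rewrite antipode_circle ll_shift_sheet0. Qed.

Lemma loop_real_eq (k : 'I_(2 * n)) (D D' : divisor G2) (d1 d2 d1' d2' : R) :
  loop_real k D d1 d2 -> D = D' -> d1 = d1' -> d2 = d2' -> loop_real k D' d1' d2'.
Proof. by move=> h <- <- <-. Qed.

(* The increments along the loops j and n + j cancel because the reflection
   x |-> - len_vw - x exchanges v_j and w_j. *)
Lemma antisym_move x a b :
  antisym_divisor (fun j => x j + a j - b j) - antisym_divisor x
    - \sum_j (anti_pt (circ (sheet0 j) (a j)) - anti_pt (circ (sheet0 j) (b j)))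
  \in @principal R G2.
Proof.
pose y j := x j + a j - b j.
pose g j := loop_drop (len_vw G j) (len_wv G j).
pose c0 j t : divisor G2 := << circ (sheet0 j) t >>.
pose c1 j t : divisor G2 := << circ (sheet1 j) t >>.
(* [X j] and [Y j] are the parts on the loops [j] and [n + j]. In each of them the coefficients, and
   also the chosen lifts of the positions, sum to 0. *)
pose X j := c0 j (y j) - c0 j (x j) - (c0 j (a j) - c0 j (b j)).
pose Y j := c1 j (- len_vw G j - y j) - c1 j (- len_vw G j - x j) + (c1 j (a j) - c1 j (b j)).
pose d j := g j (y j) - g j (x j) - (g j (a j) - g j (b j)).
have H0 j t : loop_real (sheet0 j) (c0 j t - << @vpt R G2 (Vw (sheet0 j)) >>) (g j t)
    (t - loop_len G j - g j t).
  by have := loop_real_pt G2 (sheet0 j) t; rewrite /loop_len /= ll_red_sheet0.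
have H1 j t : loop_real (sheet1 j) (c1 j t - << @vpt R G2 (Vw (sheet1 j)) >>) (g j t)
    (t - loop_len G j - g j t).
  by have := loop_real_pt G2 (sheet1 j) t; rewrite /loop_len /= ll_red_sheet1.
have gN j t : g j (- len_vw G j - t) = - 2 * len_wv G j - g j t.
  by apply: loop_drop_refl; rewrite ?len_vw_gt0 ?len_wv_gt0.
have := @principal_double X Y (fun=> 0) (fun=> 0) d (fun=> 0).
rewrite (eq_bigr (fun j => (c0 j (y j) + c1 j (- len_vw G j - y j)) -
   (c0 j (x j) + c1 j (- len_vw G j - x j)) -
   (anti_pt (circ (sheet0 j) (a j)) - anti_pt (circ (sheet0 j) (b j))))); last first.
  by move=> j _; rewrite /X /Y /anti_pt !antipode_sheet0 -/(c0 _ _) -/(c1 _ _); freeg_ring.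
rewrite !sumrB; apply => j.
- apply: (loop_real_eq (loop_realB (loop_realB (H0 j (y j)) (H0 j (x j)))
    (loop_realB (H0 j (a j)) (H0 j (b j))))); rewrite /X /d /y; [freeg_ring|ring|ring].
- apply: (loop_real_eq (loop_realD (loop_realB (H1 j (- len_vw G j - y j))
     (H1 j (- len_vw G j - x j))) (loop_realB (H1 j (a j)) (H1 j (b j)))));
    rewrite /Y /d ?gN /y; [freeg_ring|ring|ring].
- exact: edge_real0.
- by rewrite oppr0; apply: edge_real0.
Qed.

(** Moving a point along a bridge creates an increment, which the simultaneous move on the antipodal
    bridge cancels. *)
Lemma beta_move i (t t' : R) : 0 <= t <= len_beta G i -> 0 <= t' <= len_beta G i ->
  anti_pt (ept (Ebeta (sheet0 i) : edge G2) t) - anti_pt (ept (Ebeta (sheet0 i) : edge G2) t')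
  \in @principal R G2.
Proof.
move=> ht ht'; pose P k (t : R) : divisor G2 := << ept (Ebeta k : edge G2) t >>.
have ap u : 0 <= u <= len_beta G i -> antipode (ept (Ebeta (sheet0 i) : edge G2) u) =
    ept (Ebeta (sheet1 i) : edge G2) u.
  by move=> hu; rewrite antipode_ept /= ?ll_red_sheet0 // ll_shift_sheet0.
pose on (T : Type) (z u : T) j := if j == i then u else z.
have := @principal_double (fun=> 0) (fun=> 0)
  (on _ 0 (P (sheet0 i) t - P (sheet0 i) t')) (on _ 0 (P (sheet1 i) t' - P (sheet1 i) t))
  (fun=> 0) (on _ 0 (t - t')).
rewrite (bigD1 i) //= big1; last first.
  by move=> j ji; rewrite /on (negbTE ji) !addr0.
rewrite /on eqxx (_ : _ + _ + 0 = anti_pt (ept (Ebeta (sheet0 i) : edge G2) t) -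
    anti_pt (ept (Ebeta (sheet0 i) : edge G2) t')); last first.
  by rewrite /anti_pt !ap // -!/(P _ _); freeg_ring.
have B k u : 0 <= u <= len_beta G (ll_red k) ->
    @edge_real R G2 (Ebeta k) (P k u - << @vpt R G2 (Vv k) >>) (u - len_beta G (ll_red k)).
  exact: (beta_real_pt (G := G2)).
apply=> j; rewrite ?oppr0; try by exists 0, 0; split; rewrite ?addr0 //; apply: edge_real0.
  case: eqP => [->|_]; last exact: edge_real0.
  have := edge_realB (B (sheet0 i) t _) (B (sheet0 i) t' _); rewrite !ll_red_sheet0.
  move=> /(_ ht ht'); rewrite (_ : _ - _ - (_ - _) = t - t'); last by ring.
  by rewrite (_ : _ - _ - (_ - _) = P (sheet0 i) t - P (sheet0 i) t') //; freeg_ring.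
case: eqP => [->|_]; last by rewrite oppr0; apply: edge_real0.
have := edge_realB (B (sheet1 i) t' _) (B (sheet1 i) t _); rewrite !ll_red_sheet1.
move=> /(_ ht' ht); rewrite (_ : _ - _ - (_ - _) = - (t - t')); last by ring.
by rewrite (_ : _ - _ - (_ - _) = P (sheet1 i) t' - P (sheet1 i) t) //; freeg_ring.
Qed.

End Prym.

Lemma principal_eq (R : realType) (G : metric_graph R) (D D' : divisor G) :
  D \in @principal R G -> D = D' -> D' \in @principal R G.
Proof. by move=> h <-. Qed.

(** * Sliding p - p^- through the cover *)

Section Sliding.
Context (R : realType) (n : nat) (G : loop_of_loops R n).
Local Notation G2 := (double_cover G).
Local Notation circ := (circle_pt G2).
Implicit Types (p q : gpoint G2) (k : 'I_(2 * n)).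

(** Replacing q - q^- by p - p^- is absorbed by a change of coordinates, whatever the coordinates
    were. *)
Definition slide p q := forall x, exists y,
  antisym_divisor G y - antisym_divisor G x - (anti_pt p - anti_pt q) \in @principal R G2.

Lemma slide_refl p : slide p p.
Proof. by move=> x; exists x; rewrite !subrr rpred0. Qed.

Lemma slide_trans p q r : slide p q -> slide q r -> slide p r.
Proof.
move=> pq qr x; have [y hy] := pq x; have [z hz] := qr y; exists z.
by apply: (principal_eq (rpredD hy hz)); freeg_ring.
Qed.

Lemma slide_antipode p q : slide p q -> slide (antipode q) (antipode p).
Proof.
move=> pq x; have [y hy] := pq x; exists y; move: hy.
by rewrite !anti_pt_antipode opprK [- _ + _]addrC.
Qed.

(** Passing to antipodes reverses the direction of [slide]; asking for both directions gives a
    relation stable under the antipode. *)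
Definition linked p q := slide p q /\ slide q p.

Lemma linked_sym p q : linked p q -> linked q p.
Proof. by case. Qed.

Lemma linked_trans p q r : linked p q -> linked q r -> linked p r.
Proof. by move=> [h1 h2] [h3 h4]; split; [apply: slide_trans h1 h3|apply: slide_trans h4 h2]. Qed.

Lemma linked_antipode p q : linked p q -> linked (antipode p) (antipode q).
Proof. by move=> [h1 h2]; split; apply: slide_antipode. Qed.

(** The moves were constructed on the first sheet; a relation stable under the antipode transports
    them to the second. *)
Lemma linked_sheets (P : 'I_(2 * n) -> gpoint G2 -> gpoint G2 -> Prop) k p q :
  (forall k p q, P k p q -> P (ll_shift k) (antipode p) (antipode q)) ->
  (forall i p q, P (sheet0 i) p q -> linked p q) -> P k p q -> linked p q.
Proof.
move=> hP h0; case: (double_index k) => [[_ ->]|[_ ->]]; first exact: h0.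
move=> /hP; rewrite ll_shift_sheet1 => /h0 /linked_antipode.
by rewrite !antipodeK.
Qed.

Lemma linked_loop k (a b : R) : linked (circ k a) (circ k b).
Proof.
apply: (linked_sheets (k := k) (P := fun k p q => exists a b, p = circ k a /\ q = circ k b));
  last by exists a, b.
  by move=> k' p q [a' [b' [-> ->]]]; exists a', b'; rewrite !antipode_circle.
move=> i p q [{}a [{}b [-> ->]]].
suff H a' b' : slide (circ (sheet0 i) a') (circ (sheet0 i) b') by split.
(* Only the coordinate on the loop [i] changes, by [a' - b']. *)
move=> x; pose on (u : R) j := if j == i then u else 0.
exists (fun j => x j + on a' j - on b' j).
have := antisym_move G x (on a') (on b'); rewrite (bigD1 i) //= [X in _ - (_ + X)]big1 ?addr0.
  by rewrite /on eqxx.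
by move=> j ji; rewrite /on (negbTE ji) subrr.
Qed.

Lemma linked_beta k (t u : R) :
  0 <= t <= len_beta G2 k -> 0 <= u <= len_beta G2 k ->
  linked (ept (Ebeta k : edge G2) t) (ept (Ebeta k : edge G2) u).
Proof.
move=> ht hu; apply: (linked_sheets (k := k) (P := fun k p q => exists t u,
  [/\ 0 <= t <= len_beta G2 k, 0 <= u <= len_beta G2 k,
    p = ept (Ebeta k : edge G2) t & q = ept (Ebeta k : edge G2) u])); last by exists t, u; split.
  move=> k' p q [t' [u' [h1 h2 -> ->]]]; exists t', u'.
  by split; rewrite ?antipode_ept //= ll_red_shift.
move=> i p q [t' [u' [h1 h2 -> ->]]]; rewrite /= ll_red_sheet0 in h1 h2.
by split=> x; exists x; rewrite subrr sub0r rpredN; apply: beta_move.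
Qed.

Lemma linked_vertices k : linked (@vpt R G2 (Vw k)) (@vpt R G2 (Vv k)).
Proof. by rewrite -circle_pt0 -circle_pt_v; apply: linked_loop. Qed.

Lemma linked_pred k : linked (@vpt R G2 (Vv (ord_pred k))) (@vpt R G2 (Vv k)).
Proof.
apply: linked_trans (linked_sym (linked_vertices _)) _.
have := @linked_beta k 0 (len_beta G2 k).
rewrite !lexx (ltW (len_beta_gt0 G2 k)) => /(_ isT isT).
by rewrite (ept0 (Ebeta k : edge G2)) (ept_len (Ebeta k : edge G2)).
Qed.

(** Consecutive vertices are joined through a loop and a bridge, so each one is reached from index 0
    by induction. *)
Lemma linked_Vv k l : linked (@vpt R G2 (Vv k)) (@vpt R G2 (Vv l)).
Proof.
have l0 : (0 < 2 * n)%N by apply: leq_ltn_trans (ltn_ord k).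
suff H m (mn : (m < 2 * n)%N) :
    linked (@vpt R G2 (Vv (Ordinal l0))) (@vpt R G2 (Vv (Ordinal mn))).
  apply: (linked_trans (linked_sym (p := @vpt R G2 (Vv (Ordinal l0))) _)).
    by case: k => m mn; apply: H.
  by case: l => m mn; apply: H.
elim: m mn => [|m IH] mn.
  by rewrite (bool_irrelevance mn l0); split; apply: slide_refl.
apply: linked_trans (IH (ltnW mn)) _.
rewrite (_ : Ordinal (ltnW mn) = ord_pred (Ordinal mn)); first exact: linked_pred.
by apply/val_inj; rewrite /= modnDr modn_small // ltnW.
Qed.

Lemma linked_to_Vv p : exists k, linked p (@vpt R G2 (Vv k)).
Proof.
move: p; apply: gpoint_ind => [[] k|[] k t ht /andP[t0 tl]]; exists k.
- by split; apply: slide_refl.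
- exact: linked_vertices.
- rewrite -circle_pt_v (_ : ept _ t = circ k (len_wv G2 k + t)); first exact: linked_loop.
  have := @circle_ptE R _ G2 k 0 (len_wv G2 k + t); rewrite mul0r add0r => ->.
    by rewrite ltNge lerDl (ltW t0) /= addrAC subrr add0r.
  have /= := len_wv_gt0 G2 k; move: tl; rewrite /loop_len /= => h1 h2.
  by apply/andP; split; lra.
- rewrite -circle_pt_v (_ : ept _ t = circ k t); first exact: linked_loop.
  have := @circle_ptE R _ G2 k 0 t; rewrite mul0r add0r => ->; first by rewrite tl.
  have /= := len_vw_gt0 G2 k; move: tl; rewrite /loop_len /= => h1 h2.
  by apply/andP; split; lra.
- have <- := ept_len (Ebeta k : edge G2).
  by apply: linked_beta => //; rewrite lexx ltW ?len_beta_gt0.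
Qed.

Lemma linked_all p q : linked p q.
Proof.
have [k hp] := linked_to_Vv p; have [l hq] := linked_to_Vv q.
exact: linked_trans hp (linked_trans (linked_Vv k l) (linked_sym hq)).
Qed.

Context (p0 : gpoint G2).

Definition component (r : bool) : divisor G2 :=
  if r then - << p0 >> + << antipode p0 >> else 0.

Lemma componentE r : component r = if r then - anti_pt p0 else 0.
Proof. by rewrite /component /anti_pt opprB addrC. Qed.

Definition covered (D : divisor G2) := exists x r,
  D - (antisym_divisor G x + component r) \in @principal R G2.

Lemma covered_eq D D' : covered D -> D = D' -> covered D'.
Proof. by move=> h <-. Qed.

(** In the second part, p slides to [p0] and cancels the correction; in the first, it slides to the
    antipode of [p0] and creates the correction. *)
Lemma covered_step D p : covered D -> covered (D + anti_pt p).
Proof.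
move=> [x [r]]; rewrite componentE; case: r => hD.
  have [hs _] := linked_all p p0; have [y hy] := hs x; exists y, false.
  by apply: (principal_eq (rpredB hD hy)); rewrite componentE; freeg_ring.
have [hs _] := linked_all p (antipode p0); have [y hy] := hs x; exists y, true.
by apply: (principal_eq (rpredB hD hy)); rewrite componentE anti_pt_antipode; freeg_ring.
Qed.

Lemma covered_anti D F : covered D -> covered (D + (F - Nm (@antipode R n G) F)).
Proof.
(* Both signs are carried along, since the induction on [F] proceeds by differences. *)
suff H : (forall D, covered D -> covered (D + (F - Nm (@antipode R n G) F))) /\
         (forall D, covered D -> covered (D - (F - Nm (@antipode R n G) F))).
  by move=> hD; apply: H.1.
move: F; apply: freeg_zmod_ind => [|F1 F2 [h1 h1'] [h2 h2']|p].
- by rewrite raddf0 subr0; split=> E; rewrite ?addr0 ?subr0.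
- split=> E hE; rewrite raddfB /=.
    by apply: (covered_eq (h2' _ (h1 _ hE))); freeg_ring.
  by apply: (covered_eq (h2 _ (h1' _ hE))); freeg_ring.
- rewrite NmU -/(anti_pt p); split=> E; first exact: covered_step.
  by rewrite -anti_pt_antipode; apply: covered_step.
Qed.

End Sliding.

(** * Parity of the number of chips on one sheet *)

Section Parity.
Context (R : realType) (n : nat) (n_gt0 : (0 < n)%N) (G : loop_of_loops R n).
Local Notation G2 := (double_cover G).

Lemma coeff_antipode p (D : divisor G2) :
  coeff p (Nm (@antipode R n G) D) = coeff (antipode p) D.
Proof.
move: D; apply: freeg_zmod_ind => [|D1 D2 e1 e2|q]; first by rewrite !raddf0.
  by rewrite !raddfB /= e1 e2.
by rewrite NmU !coeff_point -(can2_eq (@antipodeK R n G) (@antipodeK R n G)).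
Qed.

(** The interior of a bridge is counted with its target, so the sheets are cut at the starts of the
    bridges 0 and [n]. *)
Definition on_sheet0 (p : gpoint G2) : bool := match p with
  | inl v => (ll_vertex_idx v < n)%N
  | inr y => (ll_edge_idx (val y).1 < n)%N end.

Lemma sheet0_shift (k : 'I_(2 * n)) : (ll_shift k < n)%N = ~~ (k < n)%N.
Proof.
move: k; apply: double_index_ind => j; rewrite ?ll_shift_sheet0 ?ll_shift_sheet1 /=;
  by rewrite [(n + j < n)%N]ltnNge leq_addr ltn_ord.
Qed.

Lemma on_sheet0_ept (e : edge G2) t : 0 < t < len e ->
  on_sheet0 (ept e t) = (ll_edge_idx e < n)%N.
Proof. by move=> h; rewrite (ept_inr (e := e) (t := t) h). Qed.

Lemma on_sheet0_antipode p : on_sheet0 (antipode p) = ~~ on_sheet0 p.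
Proof.
move: p; apply: gpoint_ind => [v|e t ht h]; first by case: v => k /=; rewrite sheet0_shift.
by rewrite antipode_ept // !on_sheet0_ept ?len_shift //; case: e {ht h} => k; rewrite sheet0_shift.
Qed.

Lemma on_sheet0_circle (k : 'I_(2 * n)) (t : R) : on_sheet0 (circle_pt G2 k t) = (k < n)%N.
Proof.
have [z [r [hr ->]]] := periodic_decomp t (loop_len_gt0 G2 k).
rewrite circle_ptE //; have /andP[r0 _] := hr; case: ifPn => rb.
  have : 0 <= r <= @len R G2 (Ewv k) by rewrite r0 /= ltW.
  move: r {hr r0 rb}; apply: (edge_param_ind (P := fun r p => on_sheet0 p = (k < n)%N)) => //.
move: (loop_rem_le hr rb); set u := (r - _).
by move: u; apply: (edge_param_ind (G := G2) (e := Evw k) (P := fun r p => on_sheet0 p = (k < n)%N)).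
Qed.

Definition sheet_count (D : divisor G2) : int :=
  pairing (fun p => (on_sheet0 p)%:R : int) D.

(* If F - Nm antipode F = div phi, then phi + phi o antipode is constant, so phi has
   opposite slopes at the two points where the sheets meet: the flux of phi out of
   the first sheet is twice one of them. *)
Lemma sheet_count_even (F : divisor G2) :
  F - Nm (@antipode R n G) F \in @principal R G2 ->
  exists m : int, sheet_count (F - Nm (@antipode R n G) F) = m + m.
Proof.
set D := F - _ => /principalP[V [E [hE DE]]].
pose sh (e : edge G2) : edge G2 := ll_edge_map (@ll_shift n) e.
pose shv (v : vertex G2) : vertex G2 := ll_vertex_map (@ll_shift n) v.
have shK : involutive sh by move=> e; apply: (@edge_shiftK R n G).
(* [E'] and [V'] describe the sum of the function and its antipode, whose divisor D + D^- is 0. *)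
pose E' e := E e + Nm (@antipode R n G) (E (sh e)).
pose V' v := V v + V (shv v).
have hE' e : edge_real e (E' e) (V' (tgt e) - V' (src e)).
  rewrite (_ : _ - _ = (V (tgt e) - V (src e)) + (V (tgt (sh e)) - V (src (sh e)))); last first.
    have -> : tgt (sh e) = shv (tgt e) by apply: tgt_shift.
    have -> : src (sh e) = shv (src e) by apply: src_shift.
    by rewrite /V' opprD addrACA.
  apply: edge_realD => //.
  have := edge_real_map (@src_shift R n G) (@tgt_shift R n G) (@len_shift R n G) (hE (sh e)).
  by rewrite -/(sh (sh e)) shK.
have E'0 : \sum_e E' e = 0.
  rewrite big_split /= -DE -raddf_sum /= (_ : \sum_e E (sh e) = D).
    have AA : Nm (@antipode R n G) (Nm (@antipode R n G) F) = F.
      by rewrite Nm_comp (eq_Nm (g := id)) ?Nm_id //; apply: antipodeK.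
    by rewrite /D raddfB /= AA; freeg_ring.
  by rewrite DE [RHS](reindex sh) //; apply: onW_bij; exists sh.
(* These are the bridges 0 and [n]: [e0] enters the first sheet and [e1] leaves it. *)
pose e0 : edge G2 := Ebeta (sheet0 (Ordinal n_gt0)).
pose e1 : edge G2 := Ebeta (sheet1 (Ordinal n_gt0)).
have e01 : sh e0 = e1 by rewrite /sh /= ll_shift_sheet0.
have := harmonic_src hE' E'0 (e := e0) isT.
rewrite coeffD coeff_antipode e01 => hs; exists (coeff (vpt (src e1)) (E e1)).
have src1 : antipode (vpt (src e0)) = vpt (src e1).
  by rewrite -e01 (src_shift e0).
have s0 : on_sheet0 (vpt (src e0)) = false := ord_pred_double_lt (sheet0 (Ordinal n_gt0)).
have s1 : on_sheet0 (vpt (src e1)).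
  by rewrite [on_sheet0 _](ord_pred_double_lt (sheet1 (Ordinal n_gt0))) /= addn0 n_gt0 leqnn.
have {}hs : coeff (vpt (src e0)) (E e0) = - coeff (vpt (src e1)) (E e1).
  by apply/eqP; rewrite -addr_eq0 -src1; apply/eqP.
have const (f : gpoint G2 -> int) e (b : int) : f (vpt (src e)) = b -> f (vpt (tgt e)) = b ->
    (forall t (h : 0 < (e, t).2 < len (e, t).1), f (inr (exist _ (e, t) h)) = b) ->
    pairing f (E e) = 0.
  move=> h1 h2 h3; apply: edge_real_pairing_cst (hE e).
  by rewrite h2; apply: (edge_param_ind (P := fun t p => f p = b)).
(* On [e0] the sheet indicator is 1 except at the source; adding the indicator of that vertex gives
   a constant, which pairs to 0. On [e1] the indicator of the source is subtracted instead. *)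
have cnt0 : sheet_count (E e0) = coeff (vpt (src e1)) (E e1).
  apply/eqP; rewrite -[X in _ == X]opprK -hs -addr_eq0 -[X in _ + X]mul1r; apply/eqP.
  have := pairing_coeff (E e0) (vpt (src e0)) (1 : int); rewrite intz => <-.
  rewrite -pairingD_fun; apply: (const _ _ 1) => [||t h].
  - by rewrite s0 eqxx.
  - by rewrite /= n_gt0.
  - by rewrite /= n_gt0.
have cnt1 : sheet_count (E e1) = coeff (vpt (src e1)) (E e1).
  apply/eqP; rewrite -subr_eq0 -mulN1r; apply/eqP.
  have := pairing_coeff (E e1) (vpt (src e1)) (- 1 : int); rewrite intz => <-.
  rewrite -pairingD_fun; apply: (const _ _ 0) => [||t h].
  - by rewrite s1 eqxx.
  - by rewrite /= addn0 ltnn.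
  - by rewrite /= addn0 ltnn.
(* Every other edge lies in one sheet together with its ends, so the sheet indicator is constant on
   it. *)
have cnt e : e != e0 -> e != e1 -> sheet_count (E e) = 0.
  move=> ee0 ee1; apply: (const _ _ (ll_edge_idx e < n)%N%:R) => // [|].
    case: e ee0 ee1 => k //= ee0 ee1; congr (_%:R); congr nat_of_bool.
    rewrite ord_pred_double_lt.
    have k0 : k != 0%N :> nat.
      by apply: contra ee0 => /eqP k0; apply/eqP; congr Ebeta; apply/val_inj.
    have kn : k != n :> nat.
      by apply: contra ee1 => /eqP kn; apply/eqP; congr Ebeta; apply/val_inj; rewrite /= addn0.
    by rewrite lt0n k0 leq_eqVlt (negbTE kn).
  by case: e {ee0 ee1}.
have -> : sheet_count D = \sum_e sheet_count (E e) by rewrite /sheet_count DE raddf_sum.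
rewrite (bigD1 e0) // (bigD1 e1); last first.
  by apply/eqP => -[] /=; have := n_gt0; lia.
by rewrite /= big1 ?addr0 ?cnt0 ?cnt1 // => e /andP[]; apply: cnt.
Qed.

End Parity.

(** * The norm of both parts, covering and disjointness *)

Section PrymDecomposition.
Context (R : realType) (n : nat) (n_gt0 : (0 < n)%N) (G : loop_of_loops R n).
Local Notation G2 := (double_cover G).
Context (p0 : gpoint G2).

(** The condition at [n + j] repeats the one at [j], because the reflection is an involution, and
    congruent coordinates give the same point. Multiplying by [len_vw] passes to arc length. *)
Lemma prym_partE r c : prym_part p0 r c <->
  exists x, c = divclass (antisym_divisor G x + component p0 r).
Proof.
split=> [[xi hxi <-]|[x ->]].
  exists (fun j => xi (sheet0 j) * len_vw G j); congr divclass; congr (_ + _).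
  rewrite big_double; apply: eq_bigr => j _; rewrite !loop_pointE /= ll_red_sheet0 ll_red_sheet1.
  congr (_ + << _ >>); have := hxi (sheet0 j); rewrite ll_shift_sheet0 => -[k ->].
  rewrite -[RHS](circle_pt_periodic _ _ k); congr circle_pt.
  rewrite /loop_len /= ll_red_sheet1; have := len_vw_gt0 G j => a0.
  by field; rewrite gt_eqF.
exists (double_pick (fun j => x j / len_vw G j) (fun j => - 1 - x j / len_vw G j)).
  by apply: double_index_ind => j; exists 0;
    rewrite ?ll_shift_sheet0 ?ll_shift_sheet1 ?double_pick0 ?double_pick1; ring.
congr divclass; congr (_ + _); rewrite big_double; apply: eq_bigr => j _.
rewrite !loop_pointE double_pick0 double_pick1 /= ll_red_sheet0 ll_red_sheet1.
have a0 : len_vw G j != 0 by rewrite gt_eqF ?len_vw_gt0.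
by congr (<< circle_pt _ _ _ >> + << circle_pt _ _ _ >>); field.
Qed.

Lemma Nm_component r : Nm (@cover_map R n G) (component p0 r) = 0.
Proof.
by case: r; rewrite /component ?raddf0 // raddfD raddfN /= !NmU cover_antipode addNr.
Qed.

Lemma Nm_antisym x : Nm (@cover_map R n G) (antisym_divisor G x) =
  \sum_j (<< circle_pt G j (x j) >> + << circle_pt G j (- len_vw G j - x j) >>).
Proof.
rewrite raddf_sum; apply: eq_bigr => j _; rewrite raddfD /= !NmU !cover_circle.
by rewrite ll_red_sheet0 ll_red_sheet1.
Qed.

(** The coordinates 0 and -1 are the vertices w and v, so here the norm is the canonical divisor
    itself, not just equivalent to it. *)
Lemma Nm_antisym0 : Nm (@cover_map R n G) (antisym_divisor G (fun=> 0)) = canonical_divisor G.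
Proof.
rewrite Nm_antisym canonical_ll; apply: eq_bigr => j _.
by rewrite subr0 circle_pt0 circle_pt_v addrC.
Qed.

Lemma Nm_antisym_canonical x :
  Nm (@cover_map R n G) (antisym_divisor G x) - canonical_divisor G \in @principal R G.
Proof.
rewrite -Nm_antisym0 !Nm_antisym -sumrB.
have H j t := loop_real_pt G j t.
have := @principal_loops R n G _ (fun=> 0) (fun=> 0) (fun=> 0) _ _ _.
move=> /(_ (fun j => << circle_pt G j (x j) >> + << circle_pt G j (- len_vw G j - x j) >> -
   (<< circle_pt G j 0 >> + << circle_pt G j (- len_vw G j - 0) >>))) P.
rewrite (eq_bigr (fun j => << circle_pt G j (x j) >> + << circle_pt G j (- len_vw G j - x j) >> -
   (<< circle_pt G j 0 >> + << circle_pt G j (- len_vw G j - 0) >>) + 0)); last first.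
  by move=> j _; rewrite addr0.
apply: P => [j|j|]; last by rewrite big1 // => j _; rewrite subrr.
  (* By the reflection, the increments attached to a pair of positions [x j] and
     [- len_vw G j - x j] do not depend on [x j]; in the difference of two such pairs they
     vanish. *)
  have gN t : loop_drop (len_vw G j) (len_wv G j) (- len_vw G j - t) =
      - 2 * len_wv G j - loop_drop (len_vw G j) (len_wv G j) t.
    by apply: loop_drop_refl; rewrite ?len_vw_gt0 ?len_wv_gt0.
  have := loop_realB (loop_realD (H j (x j)) (H j (- len_vw G j - x j)))
    (loop_realD (H j 0) (H j (- len_vw G j - 0))).
  rewrite !gN; move=> [D1 [D2 [E h1 h2]]]; exists D1, D2; split.
  - by rewrite -E; freeg_ring.
  - by move: h1; congr edge_real; ring.
  - by move: h2; congr edge_real; ring.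
exact: edge_real0.
Qed.

Lemma covered_prym (D : divisor G2) :
  Nm (@cover_map R n G) D - canonical_divisor G \in @principal R G -> covered p0 D.
Proof.
move=> /(principal_lift n_gt0)[Psi Psi_principal NmPsi].
have [|F DF] := @Nm_cover_kernel R n G (D - Psi - antisym_divisor G (fun=> 0)).
  by rewrite !raddfB /= NmPsi Nm_antisym0; freeg_ring.
have : covered p0 (antisym_divisor G (fun=> 0) + Psi).
  by exists (fun=> 0), false; apply: (principal_eq Psi_principal); rewrite /component; freeg_ring.
move=> /(covered_anti F) /covered_eq; apply; rewrite -DF; freeg_ring.
Qed.

(** An equivalence between the parts would make F - F^- principal for the [F] below. On the first
    sheet the loop terms of F - F^- count 0 in total, whereas p_0 - p_0^- counts 1 or -1, which is
    odd. *)
Lemma prym_parts_disjoint x y :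
  antisym_divisor G x - (antisym_divisor G y + component p0 true) \notin @principal R G2.
Proof.
apply/negP => hxy.
pose P j t : divisor G2 := << circle_pt G2 (sheet0 j) t >>.
pose F : divisor G2 := \sum_j (P j (x j) - P j (y j)) + << p0 >>.
have FE : F - Nm (@antipode R n G) F = \sum_j (anti_pt (circle_pt G2 (sheet0 j) (x j)) -
    anti_pt (circle_pt G2 (sheet0 j) (y j))) + anti_pt p0.
  rewrite /F raddfD raddf_sum /= NmU opprD addrACA -sumrB; congr (_ + _).
  by apply: eq_bigr => j _; rewrite raddfB /= !NmU /anti_pt -/(P _ _) -/(P _ _); freeg_ring.
(* Starting from the coordinates [y] and adding [x - y] leads to [x]. *)
have := antisym_move G y x y; rewrite (_ : (fun j => _) = x); last first.
  by apply/funext => j; ring.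
move=> hm; have := rpredB hxy hm => hF.
have [|m] := @sheet_count_even R n n_gt0 G F.
  by apply: (principal_eq hF); rewrite FE componentE; freeg_ring.
have cnt p : sheet_count (anti_pt p) = (on_sheet0 p)%:R - (~~ on_sheet0 p)%:R.
  by rewrite /sheet_count raddfB /= !pairingU on_sheet0_antipode.
rewrite FE /sheet_count raddfD raddf_sum /= big1 => [|j _]; last first.
  rewrite raddfB /= -!/(sheet_count _) !cnt !on_sheet0_circle subrr //.
rewrite add0r -/(sheet_count _) cnt; case: (on_sheet0 p0) => /=; lia.
Qed.

End PrymDecomposition.

Theorem proposition3p3 (R : realType) (g : nat) (hg : (2 <= g)%N)
  (G : loop_of_loops R g.-1) (p0 : gpoint (double_cover G))
  (hp0 : exists2 j : 'I_(2 * g.-1), j = 1%N :> nat &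
           @edge_interior R (double_cover G) (Ebeta j) p0) :
  prym G = prym_part p0 false `|` prym_part p0 true /\
  prym_part p0 false `&` prym_part p0 true = set0.
Proof.
have n_gt0 : (0 < g.-1)%N by rewrite -ltnS prednK // ltnW.
split; last first.
  rewrite -subset0 => c [/prym_partE[x ->] /prym_partE[y /divclassP]].
  by rewrite {1}/component addr0 => h; have := prym_parts_disjoint n_gt0 p0 x y; rewrite h.
apply/seteqP; split=> [c [D /divclassP hD <-]|c hc].
  have [x [r /divclassP ->]] := covered_prym n_gt0 p0 hD.
  by case: r; [right|left]; apply/prym_partE; exists x.
have [x [r ->]] : exists x r, c = divclass (antisym_divisor G x + component p0 r).
  by case: hc => /prym_partE[x ->]; [exists x, false|exists x, true].
exists (antisym_divisor G x + component p0 r) => //; apply/divclassP.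
by rewrite raddfD /= Nm_component addr0; apply: Nm_antisym_canonical.
Qed.
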